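(* The set of all atoms (that is, all $\mathbb T^2$-atoms and all $\mathbb T^1$-atoms) is a bounded subset of $H^1_{\mathbb R}(\mathbb T^2)$, and its linear span is a dense subspace of $H^1_{\mathbb R}(\mathbb T^2)$.
   Context: $\mathbb T$ is the circle group, and the dual group $\mathbb Z^2$ of $\mathbb T^2$ is given the lexicographic order, with positive cone $X_+=\{(n_1,n_2)\in\mathbb Z^2: n_1>0,\text{ or } n_1=0 \text{ and } n_2\ge 0\}$. $P_+$ is the orthogonal projection of $L^2(\mathbb T^2)$ onto $H^2(\mathbb T^2)=\{f\in L^2(\mathbb T^2):\widehat f(n)=0\ \ \forall n\notin X_+\}$, and $P_-=I-P_+$. $H^1_{\mathbb R}(\mathbb T^2)$ is the completion of the real vector space $\mathrm{Pol}(\mathbb T^2,\mathbb R)$ of real-valued trigonometric polynomials on $\mathbb T^2$ with respect to the norm $\|q\|_{1*}=\|P_-q\|_1+\|P_+q\|_1$ ($\|\cdot\|_1$ the $L^1(\mathbb T^2)$ norm for normalized Haar measure); the norm of the completion is also denoted $\|\cdot\|_{1*}$. This completion embeds continuously in $L^1(\mathbb T^2,\mathbb R)$ and is identified with its image: $f\in L^1(\mathbb T^2,\mathbb R)$ belongs to $H^1_{\mathbb R}(\mathbb T^2)$ when it is the $L^1$-limit of a $\|\cdot\|_{1*}$-Cauchy sequence of real-valued trigonometric polynomials. Below $J_i$ ($i=1,2$) denotes an arc in $\mathbb T$ with normalized Lebesgue measure $|J_i|$ ($|\mathbb T|=1$). A $\mathbb T^2$-atom is either the constant function $\mathbf 1$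 or a real-valued function $a(\theta_1,\theta_2)$ supported on a rectangle $J_1\times J_2\subseteq\mathbb T^2$ such that (i) $|a(\theta_1,\theta_2)|\le\min\{1/|J_1|,1/|J_2|\}$, and (ii) $\int_{J_1}a(\theta_1,\theta_2)\,d\theta_1=0=\int_{J_2}a(\theta_1,\theta_2)\,d\theta_2$ for every $(\theta_1,\theta_2)\in J_1\times J_2$. A $\mathbb T^1$-atom is either the constant function $\mathbf 1$ or a real-valued function on $\mathbb T^2$ depending on only one variable, $a(\theta_1)$ (respectively $a(\theta_2)$), supported on a rectangle $J_1\times\mathbb T$ (respectively $\mathbb T\times J_2$), such that (i$'$) $|a(\theta_i)|\le 1/|J_i|$, and (ii$'$) $\int_{J_i}a(\theta_i)\,d\theta_i=0$ (with $i=1$, respectively $i=2$). *)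

(* Defs.v *)
From HB Require Import structures.
From mathcomp Require Import all_boot all_order all_algebra.
From mathcomp Require Import complex.
From mathcomp Require Import all_classical all_reals all_analysis.

Set Implicit Arguments.
Unset Strict Implicit.
Unset Printing Implicit Defensive.

Import Order.TTheory GRing.Theory Num.Theory.
Import numFieldNormedType.Exports.
Import ComplexField.Normc.

Local Open Scope classical_set_scope.
Local Open Scope complex_scope.
Local Open Scope ring_scope.

(* The circle group is R/Z, a point being written as its representative
   theta in [0, 1[ (standing for exp (2 i pi theta)), so that normalized Haar
   measure is Lebesgue measure on [0, 1[.  Functions on the torus are functions
   on R * R whose values outside [0, 1[ * [0, 1[ are irrelevant: nothing below
   depends on them, apart from a global measurability requirement that can
   always be met by extending by zero. *)
Section Torus.
Context {R : realType}.

Local Notation line := (measurableTypeR R).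
Local Notation pt := (line * line)%type.

Definition circle : set line := `[0, 1[.

Lemma measurable_circle : measurable circle.
Proof. exact: (measurable_itv `[0%R, 1%R[). Qed.

Definition haar : set line -> \bar R :=
  mrestr (@lebesgue_measure R) measurable_circle.

HB.instance Definition _ := Measure.on haar.

Lemma haar_setT : haar setT = 1%E.
Proof.
by rewrite /haar /mrestr setTI /circle lebesgue_measure_itv/= lte_fin ltr01 oppr0 adde0.
Qed.

HB.instance Definition _ := Measure_isProbability.Build _ _ _ haar haar_setT.

Definition torus : set pt := circle `*` circle.

Definition haar2 : set pt -> \bar R := (haar \x haar)%E.

HB.instance Definition _ := Measure.on haar2.

Lemma haar2_setT : haar2 setT = 1%E.
Proof.
rewrite -setXTT /haar2 product_measure1E// -[RHS]mule1.
by congr (_ * _)%E; exact: haar_setT.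
Qed.

HB.instance Definition _ := Measure_isProbability.Build _ _ _ haar2 haar2_setT.

Definition phase (n : int * int) (x : pt) : R :=
  2 * pi * (n.1%:~R * (x.1 : R) + n.2%:~R * (x.2 : R)).

Definition character (n : int * int) (x : pt) : R[i] :=
  cos (phase n x) +i* sin (phase n x).

Definition Xplus (n : int * int) : Prop := 0 < n.1 \/ (n.1 = 0 /\ 0 <= n.2).

Definition cintegral (f : pt -> R[i]) : R[i] :=
  (\int[haar2]_x complex.Re (f x)) +i* (\int[haar2]_x complex.Im (f x)).

Definition cL2 (f : pt -> R[i]) : Prop :=
  [/\ measurable_fun setT (fun x => complex.Re (f x)),
      measurable_fun setT (fun x => complex.Im (f x)) &
      ('N[haar2]_2%:E[EFin \o (@normc R \o f)] < +oo)%E].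

Definition inner (f g : pt -> R[i]) : R[i] :=
  cintegral (fun x => f x * (g x)^*).

Definition fourier (f : pt -> R[i]) (n : int * int) : R[i] :=
  inner f (character n).

Definition H2 (f : pt -> R[i]) : Prop :=
  cL2 f /\ forall n, ~ Xplus n -> fourier f n = 0.

(* Orthogonal projection onto [H2]; a representative of the projection, which
   is unique up to almost everywhere equality, is selected by choice. *)
Definition Pplus (f : pt -> R[i]) : pt -> R[i] :=
  xget (fun=> 0) [set g | H2 g /\ forall h, H2 h -> inner (f \- g) h = 0].

Definition Pminus (f : pt -> R[i]) : pt -> R[i] := f \- Pplus f.

Definition trigpol (p : pt -> R[i]) : Prop :=
  exists (s : seq (int * int)) (c : int * int -> R[i]),
    forall x, p x = \sum_(n <- s) c n * character n x.

Definition cplx (q : pt -> R) : pt -> R[i] := fun x => (q x)%:C.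

Definition real_trigpol (q : pt -> R) : Prop := trigpol (cplx q).

Definition norm1 (f : pt -> R) : \bar R := 'N[haar2]_1[EFin \o f]%E.

Definition cnorm1 (f : pt -> R[i]) : \bar R := norm1 (@normc R \o f).

Definition norm1star (q : pt -> R) : \bar R :=
  (cnorm1 (Pminus (cplx q)) + cnorm1 (Pplus (cplx q)))%E.

(* [q] is a sequence representing, in the completion of the real trigonometric
   polynomials for [norm1star], an element whose image in L^1 is [f]. *)
Definition represents (q : (pt -> R)^nat) (f : pt -> R) : Prop :=
  [/\ forall n, real_trigpol (q n),
      forall e : R, 0 < e -> exists N : nat, forall m n : nat,
        (N <= m)%N -> (N <= n)%N -> (norm1star (q m \- q n)%R <= e%:E)%E &
      norm1 (f \- q n) @[n --> \oo] --> 0%E].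

Definition H1R (f : pt -> R) : Prop :=
  f \in Lfun haar2 1%E /\ exists q, represents q f.

(* The norm of the completion: the limit of the norms along a representing
   sequence, which does not depend on that sequence. *)
Definition H1R_norm (f : pt -> R) : \bar R :=
  xget +oo%E [set r | exists2 q, represents q f &
                                 norm1star (q n) @[n --> \oo] --> r].

(* The image in R/Z of a nondegenerate interval (with or without its endpoints)
   of length at most 1: arcs may wrap around 0, and the circle is an arc. *)
Definition circle_arc (J : set line) : Prop :=
  exists (a b : R) (ba bb : bool), [/\ a < b, b <= a + 1 &
    J = [set t | circle t /\ exists k : int,
           (t : R) + k%:~R \in Interval (BSide ba a) (BSide bb b)]].

Definition arclength (J : set line) : R := fine (haar J).

Definition const1 (a : pt -> R) : Prop := forall x, torus x -> a x = 1.

Definition rectangle_atom (a : pt -> R) : Prop :=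
  exists J1 J2 : set line,
    [/\ circle_arc J1, circle_arc J2,
        forall x, torus x -> ~ (J1 `*` J2) x -> a x = 0,
        forall x, torus x ->
          `|a x| <= Num.min (1 / arclength J1) (1 / arclength J2) &
        forall t1 t2, J1 t1 -> J2 t2 ->
          \int[haar]_(s in J1) a (s, t2) = 0 /\
          \int[haar]_(s in J2) a (t1, s) = 0].

Definition one_variable_atom (a : pt -> R) : Prop :=
  exists (J : set line) (b : line -> R),
    [/\ circle_arc J,
        (forall x, torus x -> a x = b x.1) \/ (forall x, torus x -> a x = b x.2),
        forall t, circle t -> ~ J t -> b t = 0,
        forall t, circle t -> `|b t| <= 1 / arclength J &
        \int[haar]_(s in J) b s = 0].

Definition T2_atom (a : pt -> R) : Prop :=
  measurable_fun setT a /\ (const1 a \/ rectangle_atom a).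

Definition T1_atom (a : pt -> R) : Prop :=
  measurable_fun setT a /\ (const1 a \/ one_variable_atom a).

Definition atoms : set (pt -> R) := [set a | T2_atom a \/ T1_atom a].

Definition linear_span (A : set (pt -> R)) : set (pt -> R) :=
  [set g | exists (n : nat) (c : 'I_n -> R) (a : 'I_n -> pt -> R),
      (forall i, A (a i)) /\ g = (fun x => \sum_(i < n) c i * a i x)].

Definition bounded_in_H1R (A : set (pt -> R)) : Prop :=
  A `<=` H1R /\
  exists M : R, forall a, A a -> (H1R_norm a <= M%:E)%E.

Definition dense_in_H1R (A : set (pt -> R)) : Prop :=
  A `<=` H1R /\
  forall f, H1R f -> forall e : R, 0 < e ->
    exists2 g, A g & (H1R_norm (f \- g)%R < e%:E)%E.

End Torus.

(* Main.v *)
From HB Require Import structures.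
Require Import Defs.
From mathcomp Require Import all_boot all_order all_algebra.
From mathcomp Require Import complex ring lra zify.
From mathcomp Require Import all_classical all_reals all_analysis.
From mathcomp Require Import measurable_realfun.

(** The dual group of the torus being ordered lexicographically, [P_+] acts on a
    trigonometric polynomial by keeping its frequencies in the positive cone, so that
    [norm1star] is explicit on trigonometric polynomials ([norm1star_rnorm1star]) and
    dominated there by the L2 norm ([rnorm1star_small]).

    The norm of the completion does not depend on the representing sequence
    ([H1R_norm_represents]).  This amounts to: if trigonometric polynomials tend to zero
    in L1 and their projections are Cauchy in L1, then the projections tend to zero
    ([proj_plus_vanishing]).  It is proved by duality, against trigonometric polynomials
    of modulus at most one, which compute L1 norms of trigonometric polynomials because
    [g / |g|] is approximated by [g] times a polynomial in [|g| ^ 2].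

    The same polynomial approximation of the sign shows that the indicator of
    [x.1 < s] is a bounded pointwise limit of real trigonometric polynomials; a Dynkin
    argument then makes real trigonometric polynomials dense in L2 among bounded
    measurable functions ([L2_approximable_bounded]).  In particular every bounded
    measurable function, hence every combination of atoms, is in the Hardy space
    ([bounded_represents]).

    Boundedness of the atoms is an L2 argument ([rnorm1star_atomic_bound]).  Let [a] be
    a mean-zero function bounded by [1 / d] and carried by the strip where one coordinate
    lies in an arc of measure [d], let [z] be the corresponding coordinate of the torus
    and [w] a point of the arc.  Then [a] has L2 norm at most [d ^ (-1/2)], while
    [(z - w) a] has L2 norm of order [d ^ (1/2)].  Both bounds pass to [P_+ a]: the
    commutator of [P_+] with multiplication by [z] only sees the frequencies that
    enter the positive cone when multiplied by [z], and [a] has only one of them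
    ([sqnorm2_commutator]).  Integrating [|P_+ a|] against a weight of width [d] gives
    an absolute bound in L1 ([weight_bound]).  Every atom other than the constant is
    of this form; a rectangle atom is treated as a function carried by a strip in the
    second variable, where the only frequency involved is [(0, -1)].

    Density is immediate once trigonometric polynomials are seen to be combinations of
    atoms: up to the constant, the functions [cos (phase n x + b)] are themselves atoms,
    for the full circle as arc ([real_trigpol_span]). *)

Set Implicit Arguments.
Unset Strict Implicit.
Unset Printing Implicit Defensive.

Import Order.TTheory GRing.Theory Num.Theory.
Import numFieldNormedType.Exports.
Import ComplexField.Normc.

Local Open Scope classical_set_scope.
Local Open Scope complex_scope.
Local Open Scope ring_scope.

Section Torus.
Context {R : realType}.
Local Notation line := (measurableTypeR R).
Local Notation pt := (line * line)%type.
Local Notation Re := (@complex.Re R).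
Local Notation Im := (@complex.Im R).
Implicit Types f g h p q : pt -> R[i].
Local Notation L1 := (Lfun (@haar2 R) 1%E).
Local Notation L2 := (Lfun (@haar2 R) 2%:E).

(** * Integrable and square-integrable functions on the torus *)

Lemma Lfun2_of_sqr_lty (f : pt -> R) : measurable_fun setT f ->
  (\int[haar2]_x (f x ^+ 2)%:E < +oo)%E -> f \in L2.
Proof.
move=> mf fint; rewrite inE; apply/andP; split; rewrite inE//=.
rewrite /finite_norm unlock poweR_lty//.
by under eq_integral do rewrite /= powR_mulrn// real_normK ?num_real//.
Qed.

Lemma Lfun_measurable (r : \bar R) (f : pt -> R) : f \in Lfun (@haar2 R) r -> measurable_fun setT f.
Proof. by rewrite inE => /andP[/[!inE]]. Qed.

Lemma negligible_torusC : (@haar2 R).-negligible (~` torus).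
Proof.
exists (~` torus); split => //.
  by apply: measurableC; apply: measurableX; exact: measurable_circle.
have mt : measurable (@torus R) by apply: measurableX; exact: measurable_circle.
have t1 : haar2 (@torus R) = 1%E.
  rewrite /torus /haar2 product_measure1E; [|exact: measurable_circle..].
  rewrite -[RHS]mule1; congr (_ * _)%E;
    rewrite -haar_setT /= /haar /mrestr setTI setIid//.
apply: (etrans (probability_setC (@haar2 R) mt)).
by apply: (etrans (congr1 (fun z => (1 - z)%E) t1)); rewrite subee.
Qed.

Lemma ae_torus : {ae (@haar2 R), forall x, torus x}.
Proof. exact: negligible_torusC. Qed.

Lemma Lfun2_le (f g : pt -> R) : measurable_fun setT f -> g \in L2 ->
  (forall x, torus x -> `|f x| <= `|g x|) -> f \in L2.
Proof.
move=> mf /[dup] /Lfun_measurable mg /Lfun2_integrable_sqr/integrableP[_ ig] fg.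
apply: Lfun2_of_sqr_lty => //; apply: le_lt_trans ig.
apply: ae_ge0_le_integral => //.
- by move=> x _; rewrite lee_fin sqr_ge0.
- by apply/measurable_EFinP; exact: measurable_funX.
- by apply: measurableT_comp => //; apply/measurable_EFinP; exact: measurable_funX.
- apply: (filterS _ ae_torus) => x tx _ /=.
  by rewrite lee_fin normrX -[leLHS]real_normK ?num_real// lerXn2r ?nnegrE// fg.
Qed.

Lemma Lfun2_bounded (f : pt -> R) (B : R) : measurable_fun setT f ->
  (forall x, torus x -> `|f x| <= B) -> f \in L2.
Proof.
move=> mf fB; apply: (@Lfun2_le f (cst B)) => //; first exact: Lfun_cst.
by move=> x tx /=; rewrite (le_trans (fB _ tx))// ler_norm.
Qed.

Lemma Lfun2_Lfun1 : {subset L2 <= L1}.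
Proof. by apply: Lfun_subset12; rewrite (_ : _ [set: _] = 1%E)//; exact: haar2_setT. Qed.

Lemma Lfun1D (f g : pt -> R) : f \in L1 -> g \in L1 -> f \+ g \in L1.
Proof. by move=> hf hg; exact: (@rpredD _ (Lfun _ _) f g). Qed.

Lemma Lfun2D (f g : pt -> R) : f \in L2 -> g \in L2 -> f \+ g \in L2.
Proof. exact: (@Lfun_addr_closed _ _ _ _ _ (lee1n 2)).2. Qed.

Lemma Lfun2Z (c : R) (f : pt -> R) : f \in L2 -> c \o* f \in L2.
Proof. by move=> hf; apply: (Lfun_scale c _ hf); rewrite ler1n. Qed.

Lemma Lfun1P (f : pt -> R) : f \in L1 <-> haar2.-integrable setT (EFin \o f).
Proof. exact: Lfun1_integrable. Qed.

Lemma Lfun1N (u : pt -> R) : u \in L1 -> \- u \in L1.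
Proof. by move/Lfun1P => /integrableN h; apply/Lfun1P. Qed.

Lemma Lfun1Z (c : R) (u : pt -> R) : u \in L1 -> c \*o u \in L1.
Proof.
move/Lfun1P => h; apply/Lfun1P.
have := integrableZl measurableT c h.
by apply: eq_integrable.
Qed.

Lemma Lfun1_cst (c : R) : cst c \in L1.
Proof. exact: Lfun_cst. Qed.

Lemma RintD (u v : pt -> R) : u \in L1 -> v \in L1 ->
  \int[haar2]_x (u x + v x) = \int[haar2]_x u x + \int[haar2]_x v x.
Proof. by move=> /Lfun1P hu /Lfun1P hv; exact: RintegralD. Qed.

Lemma RintZ (c : R) (u : pt -> R) : u \in L1 ->
  \int[haar2]_x (c * u x) = c * \int[haar2]_x u x.
Proof. by move=> /Lfun1P hu; exact: RintegralZl. Qed.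

Lemma Rint_cst (c : R) : \int[haar2]_x c = c.
Proof.
by rewrite Rintegral_cst// (_ : fine _ = 1) ?mulr1// (_ : _ [set: _] = 1%E)//; exact: haar2_setT.
Qed.

Lemma Rint_ae_eq (u v : pt -> R) : u \in L1 -> v \in L1 ->
  (forall x, torus x -> u x = v x) -> \int[haar2]_x u x = \int[haar2]_x v x.
Proof.
move=> hu hv uv; rewrite /Rintegral; congr fine; apply: ae_eq_integral => //.
- by apply/measurable_EFinP; exact: Lfun_measurable hu.
- by apply/measurable_EFinP; exact: Lfun_measurable hv.
- by apply: (filterS _ ae_torus) => x /uv /= ->.
Qed.

Lemma Rint_le (u v : pt -> R) : u \in L1 -> v \in L1 ->
  (forall x, torus x -> u x <= v x) -> \int[haar2]_x u x <= \int[haar2]_x v x.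
Proof.
move=> hu hv uv.
have hw := Lfun1D hv (Lfun1N hu).
have e : \int[haar2]_x (v x - u x) = \int[haar2]_x `|v x - u x|.
  apply: Rint_ae_eq => //; first exact: (Lfun_norm hw).
  by move=> x tx; rewrite ger0_norm// subr_ge0 uv.
have : 0 <= \int[haar2]_x (v x - u x) by rewrite e; apply: Rintegral_ge0.
rewrite RintD//; last exact: Lfun1N.
under [X in _ + X]eq_Rintegral do rewrite -mulN1r.
by rewrite RintZ// mulN1r subr_ge0.
Qed.

(** * Complex-valued functions and their inner product *)

Lemma normcE (z : R[i]) : normc z = Num.sqrt (Re z ^+ 2 + Im z ^+ 2).
Proof. by case: z. Qed.

Lemma normc_ge0 (z : R[i]) : 0 <= normc z.
Proof. by rewrite normcE sqrtr_ge0. Qed.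

Lemma normc2E (z : R[i]) : normc z ^+ 2 = Re z ^+ 2 + Im z ^+ 2.
Proof. by rewrite normcE sqr_sqrtr// addr_ge0 ?sqr_ge0. Qed.

Lemma le_Re_normc (z : R[i]) : `|Re z| <= normc z.
Proof.
rewrite -(ler_pXn2r (n := 2)) ?nnegrE ?normc_ge0//.
by rewrite real_normK ?num_real// normc2E lerDl sqr_ge0.
Qed.

Lemma le_Im_normc (z : R[i]) : `|Im z| <= normc z.
Proof.
rewrite -(ler_pXn2r (n := 2)) ?nnegrE ?normc_ge0//.
by rewrite real_normK ?num_real// normc2E lerDr sqr_ge0.
Qed.

Lemma normc_le_ReIm (z : R[i]) : normc z <= `|Re z| + `|Im z|.
Proof.
rewrite -(ler_pXn2r (n := 2)) ?nnegrE ?normc_ge0 ?addr_ge0//.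
by rewrite normc2E sqrrD !real_normK ?num_real// -addrA lerD2l lerDr mulrn_wge0// mulr_ge0.
Qed.

Lemma normc_conj (z : R[i]) : normc z^* = normc z.
Proof. by rewrite !normcE; case: z => a b /=; rewrite sqrrN. Qed.

Lemma normc_real (a : R) : normc a%:C = `|a|.
Proof. by rewrite normcE /= expr0n addr0 sqrtr_sqr. Qed.

Lemma ReD (z w : R[i]) : Re (z + w) = Re z + Re w.
Proof. by case: z w => ? ? []. Qed.
Lemma ImD (z w : R[i]) : Im (z + w) = Im z + Im w.
Proof. by case: z w => ? ? []. Qed.
Lemma ReM (z w : R[i]) : Re (z * w) = Re z * Re w - Im z * Im w.
Proof. by case: z w => ? ? []. Qed.
Lemma ImM (z w : R[i]) : Im (z * w) = Re z * Im w + Im z * Re w.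
Proof. by case: z w => ? ? [? ?] /=; rewrite addrC. Qed.
Lemma ReJ (z : R[i]) : Re z^* = Re z. Proof. by case: z. Qed.
Lemma ImJ (z : R[i]) : Im z^* = - Im z. Proof. by case: z. Qed.
Lemma mulcJ (z : R[i]) : z * z^* = (normc z ^+ 2)%:C.
Proof.
by rewrite normc2E; case: z => a b; apply/eqP; rewrite eq_complex /= -!expr2 mulrN opprK
  mulrN [b * a]mulrC addNr !eqxx.
Qed.

Lemma complexP (z w : R[i]) : Re z = Re w -> Im z = Im w -> z = w.
Proof. by case: z w => ? ? [? ?] /= -> ->. Qed.

(** Complex-valued integrable functions, through their real and imaginary parts. *)
Definition cL1 (f : pt -> R[i]) := (Re \o f \in L1) /\ (Im \o f \in L1).

Lemma measurable_normc (f : pt -> R[i]) : measurable_fun setT (Re \o f) ->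
  measurable_fun setT (Im \o f) -> measurable_fun setT (@normc R \o f).
Proof.
move=> mr mi.
rewrite (_ : _ \o _ = (@Num.sqrt R) \o (fun x => Re (f x) ^+ 2 + Im (f x) ^+ 2)).
  apply: measurableT_comp; first exact: (continuous_measurable_fun (@sqrt_continuous R)).
  by apply: measurable_funD; exact: measurable_funX.
by apply/funext => x /=; rewrite normcE.
Qed.

(** Square-integrability of the modulus amounts to that of both parts; this is how
    membership in [cL2] is handled below. *)
Lemma cL2P (f : pt -> R[i]) : cL2 f <-> (Re \o f \in L2 /\ Im \o f \in L2).
Proof.
split=> [[mr mi nf]|[fr fi]].
  have nL : @normc R \o f \in L2.
    by rewrite inE; apply/andP; split; rewrite inE//=; exact: measurable_normc.
  by split; apply: (Lfun2_le _ nL) => // x _ /=;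
    rewrite [leRHS]ger0_norm ?normc_ge0// ?le_Re_normc ?le_Im_normc.
have mr := Lfun_measurable fr; have mi := Lfun_measurable fi.
split => //.
suff : @normc R \o f \in L2 by rewrite inE => /andP[_ /[!inE]].
apply: Lfun2_of_sqr_lty; first exact: measurable_normc.
apply: integrable_lty => //.
under eq_fun do rewrite /= normc2E EFinD.
by apply: integrableD => //; [exact: (Lfun2_integrable_sqr fr)|exact: (Lfun2_integrable_sqr fi)].
Qed.

Lemma cL2_cL1 f : cL2 f -> cL1 f.
Proof. by move=> /cL2P[/Lfun2_Lfun1 ? /Lfun2_Lfun1 ?]. Qed.

Lemma cL1D f g : cL1 f -> cL1 g -> cL1 (f \+ g).
Proof.
move=> [fr fi] [gr gi]; split.
  by rewrite (_ : _ \o _ = (Re \o f) \+ (Re \o g)); [exact: Lfun1D|apply/funext => x /=;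
    rewrite ReD].
by rewrite (_ : _ \o _ = (Im \o f) \+ (Im \o g)); [exact: Lfun1D|apply/funext => x /=; rewrite ImD].
Qed.

Lemma cL1Z c f : cL1 f -> cL1 (fun x => c * f x).
Proof.
move=> [fr fi]; split.
  rewrite (_ : _ \o _ = (Re c \*o (Re \o f)) \+ (- Im c \*o (Im \o f))).
    by apply: Lfun1D; exact: Lfun1Z.
  by apply/funext => x /=; rewrite ReM mulNr.
rewrite (_ : _ \o _ = (Re c \*o (Im \o f)) \+ (Im c \*o (Re \o f))).
  by apply: Lfun1D; exact: Lfun1Z.
by apply/funext => x /=; rewrite ImM.
Qed.

Lemma cL2D f g : cL2 f -> cL2 g -> cL2 (f \+ g).
Proof.
move=> /cL2P[fr fi] /cL2P[gr gi]; apply/cL2P; split.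
  by rewrite (_ : _ \o _ = (Re \o f) \+ (Re \o g)); [exact: Lfun2D|apply/funext => x /=;
    rewrite ReD].
by rewrite (_ : _ \o _ = (Im \o f) \+ (Im \o g)); [exact: Lfun2D|apply/funext => x /=; rewrite ImD].
Qed.

Lemma cL2Z c f : cL2 f -> cL2 (fun x => c * f x).
Proof.
move=> /cL2P[fr fi]; apply/cL2P; split.
  rewrite (_ : _ \o _ = (Re c \o* (Re \o f)) \+ (- Im c \o* (Im \o f))).
    by apply: Lfun2D; exact: Lfun2Z.
  by apply/funext => x /=; rewrite ReM mulrN ![_ * Re c]mulrC ![_ * Im c]mulrC.
rewrite (_ : _ \o _ = (Re c \o* (Im \o f)) \+ (Im c \o* (Re \o f))).
  by apply: Lfun2D; exact: Lfun2Z.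
by apply/funext => x /=; rewrite ImM ![_ * Re c]mulrC ![_ * Im c]mulrC.
Qed.

Lemma cL2N f : cL2 f -> cL2 (\- f).
Proof.
by move=> /(cL2Z (-1)); rewrite (_ : (fun x => _) = \- f)//; apply/funext => x /=; rewrite mulN1r.
Qed.

Lemma cL2B f g : cL2 f -> cL2 g -> cL2 (f \- g).
Proof. by move=> hf /cL2N; exact: cL2D. Qed.

Lemma cL1_inner f g : cL2 f -> cL2 g -> cL1 (fun x => f x * (g x)^*).
Proof.
move=> /cL2P[fr fi] /cL2P[gr gi]; split.
  rewrite (_ : _ \o _ = ((Re \o f) \* (Re \o g)) \+ ((Im \o f) \* (Im \o g))).
    by apply: Lfun1D; exact: Lfun2_mul_Lfun1.
  by apply/funext => x /=; rewrite ReM ReJ ImJ mulrN opprK.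
rewrite (_ : _ \o _ = \- ((Re \o f) \* (Im \o g)) \+ ((Im \o f) \* (Re \o g))).
  by apply: Lfun1D; [apply: Lfun1N|]; exact: Lfun2_mul_Lfun1.
by apply/funext => x /=; rewrite ImM ReJ ImJ mulrN.
Qed.

Lemma cintegralD f g : cL1 f -> cL1 g -> cintegral (f \+ g) = cintegral f + cintegral g.
Proof.
move=> [/Lfun1P fr /Lfun1P fi] [/Lfun1P gr /Lfun1P gi]; apply: complexP => /=.
  by under eq_Rintegral do rewrite ReD; exact: RintegralD.
by under eq_Rintegral do rewrite ImD; exact: RintegralD.
Qed.

Lemma cintegralZ c f : cL1 f -> cintegral (fun x => c * f x) = c * cintegral f.
Proof.
move=> [fr fi]; apply: complexP; rewrite ?ReM ?ImM /=.
  under eq_Rintegral do rewrite ReM.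
  rewrite RintegralB//; [|by apply/Lfun1P; exact: Lfun1Z..].
  by rewrite !RintegralZl//; exact/Lfun1P.
under eq_Rintegral do rewrite ImM.
rewrite RintegralD//; [|by apply/Lfun1P; exact: Lfun1Z..].
by rewrite !RintegralZl//; exact/Lfun1P.
Qed.

Lemma cintegralJ f : cL1 f -> cintegral (fun x => (f x)^*) = (cintegral f)^*.
Proof.
move=> [fr fi]; apply: complexP => /=.
  by under eq_Rintegral do rewrite ReJ.
under eq_Rintegral do rewrite ImJ -mulN1r.
by rewrite RintegralZl//; [rewrite mulN1r|exact/Lfun1P].
Qed.

Lemma innerDl f g h : cL2 f -> cL2 g -> cL2 h -> inner (f \+ g) h = inner f h + inner g h.
Proof.
move=> hf hg hh; rewrite /inner -cintegralD; [|exact: cL1_inner..].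
by congr cintegral; apply/funext => x /=; rewrite mulrDl.
Qed.

Lemma innerZl c f h : cL2 f -> cL2 h -> inner (fun x => c * f x) h = c * inner f h.
Proof.
move=> hf hh; rewrite /inner -cintegralZ; [|exact: cL1_inner].
by congr cintegral; apply/funext => x /=; rewrite mulrA.
Qed.

Lemma innerC f g : cL2 f -> cL2 g -> inner g f = (inner f g)^*.
Proof.
move=> hf hg; rewrite /inner -cintegralJ; [|exact: cL1_inner].
by congr cintegral; apply/funext => x /=; apply: complexP; rewrite !(ReM, ImM, ReJ, ImJ); ring.
Qed.

Lemma innerNl f h : cL2 f -> cL2 h -> inner (\- f) h = - inner f h.
Proof.
move=> hf hh; rewrite (_ : \- f = fun x => -1 * f x) ?innerZl ?mulN1r//.
by apply/funext => x /=; rewrite mulN1r.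
Qed.

Lemma innerBl f g h : cL2 f -> cL2 g -> cL2 h -> inner (f \- g) h = inner f h - inner g h.
Proof. by move=> hf hg hh; rewrite innerDl ?innerNl//; exact: cL2N. Qed.

Lemma innerDr f g h : cL2 f -> cL2 g -> cL2 h -> inner h (f \+ g) = inner h f + inner h g.
Proof.
move=> hf hg hh.
by rewrite innerC ?innerDl// ?rmorphD/= -?innerC//; exact: cL2D.
Qed.

Lemma innerNr f h : cL2 f -> cL2 h -> inner h (\- f) = - inner h f.
Proof. by move=> hf hh; rewrite innerC ?innerNl ?rmorphN/= -?innerC//; exact: cL2N. Qed.

Lemma innerBr f g h : cL2 f -> cL2 g -> cL2 h -> inner h (f \- g) = inner h f - inner h g.
Proof. by move=> hf hg hh; rewrite innerDr ?innerNr//; exact: cL2N. Qed.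

(** * The L1 norm and the squared L2 norm as real numbers *)

(** The square of the L2 norm, as a real number; it is meaningful on [cL2] only. *)
Definition sqnorm2 (f : pt -> R[i]) : R := \int[haar2]_x (normc (f x) ^+ 2).

(** The L1 norm as a real number; it is meaningful on [cL1] only. *)
Definition rnorm1 (f : pt -> R[i]) : R := \int[haar2]_x normc (f x).

Lemma inner_self f : inner f f = (sqnorm2 f)%:C.
Proof.
apply: complexP => /=; first by apply: eq_Rintegral => x _; rewrite mulcJ.
under eq_Rintegral do rewrite mulcJ /=.
by rewrite Rintegral_cst// mul0r.
Qed.

Lemma sqnorm2_ge0 f : 0 <= sqnorm2 f.
Proof. by apply: Rintegral_ge0 => x _; rewrite sqr_ge0. Qed.

Lemma rnorm1_ge0 f : 0 <= rnorm1 f.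
Proof. by apply: Rintegral_ge0 => x _; rewrite normc_ge0. Qed.

Lemma cL2_sqr f : cL2 f -> (fun x => normc (f x) ^+ 2) \in L1.
Proof.
move=> /cL2P[fr fi].
rewrite (_ : (fun x => _) = (fun x => Re (f x) ^+ 2) \+ (fun x => Im (f x) ^+ 2)).
  by apply: Lfun1D; apply/Lfun1P; apply: Lfun2_integrable_sqr.
by apply/funext => x /=; rewrite normc2E.
Qed.

Lemma cL2_normc f : cL2 f -> (@normc R \o f) \in L2.
Proof.
by move=> [mr mi nf]; rewrite inE; apply/andP; split; rewrite inE//=; exact: measurable_normc.
Qed.

Lemma cL1_normc f : cL1 f -> (fun x => normc (f x)) \in L1.
Proof.
move=> [fr fi].
have /Lfun1P i1 := Lfun1D (Lfun_norm fr) (Lfun_norm fi).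
apply/Lfun1P; apply: le_integrable i1 => //.
  apply/measurable_EFinP; exact: (measurable_normc (Lfun_measurable fr) (Lfun_measurable fi)).
move=> x _ /=; rewrite lee_fin ger0_norm ?normc_ge0// ger0_norm ?addr_ge0//.
exact: normc_le_ReIm.
Qed.

Lemma sqnorm2Z c f : cL2 f -> sqnorm2 (fun x => c * f x) = normc c ^+ 2 * sqnorm2 f.
Proof.
move=> hf; rewrite /sqnorm2 -RintZ//; last exact: cL2_sqr.
by apply: eq_Rintegral => x _; rewrite normcM exprMn.
Qed.

Lemma le_sqnorm2 f g : cL2 f -> cL2 g -> (forall x, torus x -> normc (f x) <= normc (g x)) ->
  sqnorm2 f <= sqnorm2 g.
Proof.
move=> hf hg fg; apply: Rint_le; [exact: cL2_sqr..|] => x tx.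
by rewrite lerXn2r ?nnegrE ?normc_ge0// fg.
Qed.

Lemma sqnorm2D_le f g : cL2 f -> cL2 g -> sqnorm2 (f \+ g) <= 2 * sqnorm2 f + 2 * sqnorm2 g.
Proof.
move=> hf hg; have ig := cL2_sqr hg; have jf := cL2_sqr hf.
have s1 := cL2_sqr (cL2D hf hg).
rewrite /sqnorm2 -!RintZ// -RintD//; [|exact: (Lfun1Z 2 jf)|exact: (Lfun1Z 2 ig)].
apply: Rint_le => //; first exact: (Lfun1D (Lfun1Z 2 jf) (Lfun1Z 2 ig)).
move=> x _ /=; rewrite !normc2E ReD ImD -subr_ge0.
rewrite (_ : _ - _ = (Re (f x) - Re (g x)) ^+ 2 + (Im (f x) - Im (g x)) ^+ 2); last by ring.
by rewrite addr_ge0 ?sqr_ge0.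
Qed.

Lemma rnorm1D_le f g : cL1 f -> cL1 g -> rnorm1 (f \+ g) <= rnorm1 f + rnorm1 g.
Proof.
move=> hf hg; have ig := cL1_normc hg; have jf := cL1_normc hf.
rewrite /rnorm1 -RintD//; apply: Rint_le.
- exact: cL1_normc (cL1D hf hg).
- exact: Lfun1D.
- by move=> x _; exact: le_normcD.
Qed.

(** The inequality between the L1 and the L2 norm on a probability space, in the
    square-root-free form given by the inequality of arithmetic and geometric means. *)
Lemma rnorm1_le_sqnorm2 f (e : R) : cL2 f -> 0 < e -> rnorm1 f <= (sqnorm2 f / e + e) / 2.
Proof.
move=> hf e0; have jf := cL2_sqr hf; have i1 := cL1_normc (cL2_cL1 hf).
have iz := Lfun1Z (e^-1 / 2) jf.
rewrite [leRHS](_ : _ = \int[haar2]_x ((e^-1 / 2) * normc (f x) ^+ 2 + e / 2)).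
  apply: Rint_le => //; first exact: (Lfun1D iz (Lfun1_cst _)).
  move=> x _; rewrite -subr_ge0.
  rewrite (_ : _ - _ = (normc (f x) - e) ^+ 2 / (2 * e)); last by field; rewrite gt_eqF.
  by rewrite divr_ge0 ?sqr_ge0// mulr_ge0// ltW.
rewrite RintD//; last exact: Lfun1_cst.
rewrite (RintZ _ jf) (Rint_cst (e / 2)).
by rewrite -/(sqnorm2 f); field; rewrite gt_eqF.
Qed.

Lemma cnorm1E f : cL1 f -> cnorm1 f = (rnorm1 f)%:E.
Proof.
move=> hf; have /Lfun1P i1 := cL1_normc hf.
rewrite /cnorm1 /norm1 Lnorm1 /rnorm1 /Rintegral fineK ?integrable_fin_num//.
by apply: eq_integral => x _ /=; rewrite ger0_norm ?normc_ge0.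
Qed.

Lemma rnorm1N f : rnorm1 (\- f) = rnorm1 f.
Proof. by apply: eq_Rintegral => x _; rewrite normcN. Qed.
Lemma sqnorm2N f : sqnorm2 (\- f) = sqnorm2 f.
Proof. by apply: eq_Rintegral => x _; rewrite normcN. Qed.

Lemma rnorm1_small f (e : R) : cL2 f -> 0 < e -> sqnorm2 f <= e ^+ 2 -> rnorm1 f <= e.
Proof.
move=> hf e0 fe; apply: (le_trans (rnorm1_le_sqnorm2 hf e0)).
rewrite ler_pdivrMr// mulr_natr mulr2n lerD2r ler_pdivrMr//.
Qed.

Lemma rnorm1B_le f g : cL1 f -> cL1 g -> rnorm1 f <= rnorm1 g + rnorm1 (f \- g).
Proof.
move=> hf hg; have hN : cL1 (\- g).
  by have := cL1Z (-1) hg; rewrite (_ : (fun x => _) = \- g)//; apply/funext => x /=;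
    rewrite mulN1r.
rewrite [in leLHS](_ : f = g \+ (f \- g)); first by apply: rnorm1D_le => //; exact: cL1D.
by apply/funext => x /=; rewrite addrC subrK.
Qed.

Lemma rnorm1BC f g : rnorm1 (f \- g) = rnorm1 (g \- f).
Proof. by rewrite -rnorm1N; congr rnorm1; apply/funext => x /=; rewrite opprB. Qed.

Lemma sqnorm2BC f g : sqnorm2 (f \- g) = sqnorm2 (g \- f).
Proof. by rewrite -sqnorm2N; congr sqnorm2; apply/funext => x /=; rewrite opprB. Qed.

Lemma rnorm1_eq f g : cL2 f -> cL2 g -> sqnorm2 (f \- g) = 0 -> rnorm1 f = rnorm1 g.
Proof.
move=> hf hg fg0.
have d0 : rnorm1 (f \- g) = 0.
  apply/eqP; rewrite eq_le rnorm1_ge0 andbT; apply/ler_addgt0Pl => e e0; rewrite addr0.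
  by apply: rnorm1_small => //; [exact: cL2B|rewrite fg0 sqr_ge0].
apply/eqP; rewrite eq_le; apply/andP; split.
  by rewrite (le_trans (rnorm1B_le (cL2_cL1 hf) (cL2_cL1 hg)))// d0 addr0.
by rewrite (le_trans (rnorm1B_le (cL2_cL1 hg) (cL2_cL1 hf)))// rnorm1BC d0 addr0.
Qed.

(** * Integrals over the circle *)

Lemma haar_integrable_bounded (D : set line) (u : line -> R) (B : R) : measurable D ->
  measurable_fun setT u -> (forall t, D t -> `|u t| <= B) -> (@haar R).-integrable D (EFin \o u).
Proof.
move=> mD mu uB.
apply: (@le_integrable _ _ _ (@haar R) D mD _ (EFin \o cst B)).
- by apply/measurable_EFinP; exact: measurable_funTS.
- by move=> x Dx /=; rewrite lee_fin (le_trans (uB _ Dx))// ler_norm.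
- exact: finite_measure_integrable_cst.
Qed.

(** Integrals for Haar measure on the circle are Lebesgue integrals on [[0, 1]], to
    which the fundamental theorem of calculus applies. *)
Lemma haar_Rint_circle (u : line -> R) : measurable_fun setT u ->
  (exists B, forall t, 0 <= t <= 1 -> `|u t| <= B) ->
  \int[haar]_(t in circle) u t = \int[lebesgue_measure]_(t in `[0, 1]) u t.
Proof.
move=> mu [B uB].
rewrite -(Rintegral_itv_bndo_bndc (a := BLeft (0:R))); last first.
  apply: (@le_integrable _ _ _ (@lebesgue_measure R) _ _ _ (EFin \o cst B)).
  - exact: measurable_itv.
  - by apply/measurable_EFinP; exact: measurable_funTS.
  - move=> x /=; rewrite in_itv/= => /andP[x0 x1].
    by rewrite lee_fin (le_trans (uB _ _)) ?ler_norm// x0 ltW.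
  - apply: measurable_bounded_integrable => //.
    + apply: (@eq_ind_r _ _ (fun z => (z < +oo)%E) _ _ (@lebesgue_measure_itv R `[0%R, 1%R[)).
      by rewrite /= lte_fin ltr01 oppr0 adde0 ltry.
    + exact: bounded_cst.
rewrite /Rintegral; congr fine.
apply: eq_measure_integral => A mA Ac.
by rewrite /= /haar /mrestr setIidl.
Qed.

Lemma is_derive_sin_affine (c b x : R) : c != 0 ->
  is_derive x 1 (fun t => c^-1 * sin (c * t + b)) (cos (c * x + b)).
Proof.
move=> c0.
have h : is_derive x 1 (fun t : R => c * t + b) c.
  by apply: is_derive_eq; rewrite addr0 scaler1 ?mulr1.
have := @is_derive1_comp _ (@sin R) (fun t : R => c * t + b) x _ _ (is_derive_sin (c * x + b)) h.
move=> /(@is_deriveZ _ _ _ _ c^-1) h2.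
apply: (@is_derive_eq _ _ _ _ _ _ _ _ h2).
by rewrite /= /GRing.scale /= mulrCA mulVf// mulr1.
Qed.

Lemma continuous_cos_affine (c b : R) : continuous (fun t => cos (c * t + b)).
Proof.
move=> x; apply: (@continuous_comp _ _ _ (fun t => c * t + b) (@cos R)).
  by apply: cvgD; [apply: cvgM; [exact: cvg_cst|exact: cvg_id]|exact: cvg_cst].
exact: continuous_cos.
Qed.

Lemma continuous_sin_affine (c b : R) : continuous (fun t => c^-1 * sin (c * t + b)).
Proof.
move=> x; apply: cvgM; first exact: cvg_cst.
apply: (@continuous_comp _ _ _ (fun t => c * t + b) (@sin R)).
  by apply: cvgD; [apply: cvgM; [exact: cvg_cst|exact: cvg_id]|exact: cvg_cst].
exact: continuous_sin.
Qed.

Lemma haar_Rint_circle_eq0 (u : line -> R) : (forall t, circle t -> u t = 0) ->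
  \int[haar]_(t in circle) u t = 0.
Proof.
move=> u0; transitivity (\int[haar]_(t in circle) (0 : R)).
  by apply: eq_Rintegral => t /set_mem/u0.
by rewrite /Rintegral integral0.
Qed.

Lemma sin_periodz (x : R) (k : int) : sin (x + 2 * pi * k%:~R) = sin x.
Proof.
have p n (y : R) : sin (y + 2 * pi * n%:R) = sin y.
  rewrite (_ : 2 * pi * n%:R = (pi *+ 2) *+ n); first exact: (periodicn (@sinD2pi R)).
  by rewrite -[RHS]mulr_natr -[pi *+ 2]mulr_natr [pi * _]mulrC.
case: k => n; first by rewrite -pmulrn.
by rewrite NegzE mulrNz mulrN -pmulrn -[in RHS](subrK (2 * pi * n.+1%:R) x) p.
Qed.

(** A nontrivial character of the circle has mean zero.  The shift [b] makes the lemma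
    cover the sine as well. *)
Lemma cos_mean0 (k : int) (b : R) : k != 0 ->
  \int[haar]_(t in circle) cos (2 * pi * k%:~R * t + b) = 0.
Proof.
move=> k0; have c0 : 2 * pi * k%:~R != 0 :> R.
  by rewrite !mulf_neq0 ?intr_eq0// gt_eqF// pi_gt0.
have cc := @continuous_cos_affine (2 * pi * k%:~R) b.
rewrite haar_Rint_circle; last 2 first.
- exact: continuous_measurable_fun.
- by exists 1 => t _; rewrite ler_norml cos_geN1 cos_le1.
(* The primitive takes the same value at 0 and 1. *)
rewrite /Rintegral (@continuous_FTC2 _ _ (fun t => (2 * pi * k%:~R)^-1 * sin
  (2 * pi * k%:~R * t + b))) //.
- rewrite mulr1 mulr0 add0r [_ + b]addrC sin_periodz subee//.
- exact: continuous_subspaceT.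
- split.
  + by move=> x _; have := is_derive_sin_affine b x c0; case.
  + apply: cvg_at_right_filter; exact: continuous_sin_affine.
  + apply: cvg_at_left_filter; exact: continuous_sin_affine.
- by move=> x _; rewrite derive1E; have := is_derive_sin_affine b x c0; case.
Qed.

(** Fubini, in both orders, for functions that are measurable everywhere and bounded on
    the fundamental domain only: outside of it they are first replaced by zero. *)
Lemma Rint_fubini (u : pt -> R) (B : R) : measurable_fun setT u ->
  (forall x, torus x -> `|u x| <= B) ->
  \int[haar2]_x u x = \int[haar]_(s in circle) \int[haar]_(t in circle) u (s, t) /\
  \int[haar2]_x u x = \int[haar]_(t in circle) \int[haar]_(s in circle) u (s, t).
Proof.
move=> mu uB.
have B0 : 0 <= B.
  have t0 : torus ((0, 0) : pt) by split; rewrite /circle /= in_itv/= lexx ltr01.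
  exact: le_trans (uB _ t0).
have mt : measurable (@torus R) by apply: measurableX; exact: measurable_circle.
pose v := u \_ torus.
have mv : measurable_fun setT v by apply/(measurable_restrictT _ mt); exact: measurable_funTS.
have vB x : `|v x| <= B.
  by rewrite /v patchE; case: ifPn => [/set_mem/uB//|_]; rewrite normr0.
have -> : \int[haar2]_x u x = \int[haar2]_x v x.
  apply: Rint_ae_eq.
  - exact/Lfun2_Lfun1/(Lfun2_bounded mu uB).
  - by apply: Lfun2_Lfun1; apply: (Lfun2_bounded mv) => x _; exact: vB.
  - by move=> x tx; rewrite /v patchE mem_set.
have iv : (haar \x haar)%E.-integrable setT (EFin \o v).
  by apply/Lfun1P; apply: Lfun2_Lfun1; apply: (Lfun2_bounded mv) => x _; exact: vB.
have m1 s : measurable_fun setT (fun t => v (s, t)).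
  by apply: measurableT_comp => //; exact: pair1_measurable.
have m2 t : measurable_fun setT (fun s => v (s, t)).
  by apply: measurableT_comp => //; exact: pair2_measurable.
have E1 s : (\int[haar]_t (v (s, t))%:E = (\int[haar]_t v (s, t))%:E)%E.
  rewrite fineK//; apply: integrable_fin_num => //.
  by apply: (haar_integrable_bounded (B := B)) => // t _; exact: vB.
have E2 t : (\int[haar]_s (v (s, t))%:E = (\int[haar]_s v (s, t))%:E)%E.
  rewrite fineK//; apply: integrable_fin_num => //.
  by apply: (haar_integrable_bounded (B := B)) => // s _; exact: vB.
split.
  rewrite {1}/Rintegral -(integral12_prod_meas1 iv) /fubini_F.
  under eq_integral do rewrite E1.
  rewrite -/(Rintegral _ _ _) [RHS]Rintegral_mkcond; apply: eq_Rintegral => s _.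
  rewrite patchE; case: ifPn => [/set_mem cs|sc].
    rewrite [RHS]Rintegral_mkcond; apply: eq_Rintegral => t _.
    by rewrite /v !patchE in_setX mem_set.
  under eq_Rintegral do rewrite /v patchE in_setX (negbTE sc) /=.
  by rewrite Rintegral_cst// mul0r.
rewrite {1}/Rintegral -(integral21_prod_meas1 iv) /fubini_G.
under eq_integral do rewrite E2.
rewrite -/(Rintegral _ _ _) [RHS]Rintegral_mkcond; apply: eq_Rintegral => t _.
rewrite patchE; case: ifPn => [/set_mem ct|tc].
  rewrite [RHS]Rintegral_mkcond; apply: eq_Rintegral => s _.
  by rewrite /v !patchE in_setX [t \in _]mem_set// andbT.
under eq_Rintegral do rewrite /v patchE in_setX (negbTE tc) andbF /=.
by rewrite Rintegral_cst// mul0r.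
Qed.

(** * Characters, trigonometric polynomials, Parseval and Bessel *)

Lemma phaseD n k (x : pt) : phase (n + k) x = phase n x + phase k x.
Proof. by rewrite /phase /= !intrD; ring. Qed.

Lemma phaseN n (x : pt) : phase (- n) x = - phase n x.
Proof. by rewrite /phase /= !mulrNz; ring. Qed.

Lemma charD n k (x : pt) : character (n + k) x = character n x * character k x.
Proof.
apply: complexP; rewrite ?ReM ?ImM /= phaseD ?cosD ?sinD //.
by rewrite addrC mulrC [X in _ + X]mulrC; ring.
Qed.

Lemma charN n (x : pt) : character (- n) x = (character n x)^*.
Proof. by rewrite /character phaseN cosN sinN. Qed.

Lemma char0 (x : pt) : character 0 x = 1.
Proof. by rewrite /character /phase /= !mul0r addr0 mulr0 cos0 sin0. Qed.

Lemma normc_char n (x : pt) : normc (character n x) = 1.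
Proof. by rewrite normcE /= cos2Dsin2 sqrtr1. Qed.

Lemma measurable_phase n : measurable_fun setT (@phase R n).
Proof.
rewrite /phase; apply: measurable_funM => //; apply: measurable_funD;
  by apply: measurable_funM.
Qed.

Lemma cL2_bounded f (B : R) : measurable_fun setT (Re \o f) -> measurable_fun setT (Im \o f) ->
  (forall x, torus x -> normc (f x) <= B) -> cL2 f.
Proof.
move=> mr mi fB; apply/cL2P; split; apply: (@Lfun2_bounded _ B) => // x tx;
  by [rewrite (le_trans (le_Re_normc _))// fB|rewrite (le_trans (le_Im_normc _))// fB].
Qed.

Lemma measurable_cos_phase n (b : R) : measurable_fun setT (fun x : pt => cos (phase n x + b)).
Proof.
apply: measurableT_comp; first exact: (continuous_measurable_fun (@continuous_cos R)).
by apply: measurable_funD => //; exact: measurable_phase.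
Qed.

Lemma sin_cos (y : R) : sin y = cos (y + - (pi / 2)).
Proof. by rewrite -[in LHS](subrK (pi / 2) y) sinDpihalf. Qed.

Lemma measurable_Re_char n : measurable_fun setT (Re \o @character R n).
Proof.
have := @measurable_cos_phase n 0.
by apply: eq_measurable_fun => x _ /=; rewrite addr0.
Qed.

Lemma measurable_Im_char n : measurable_fun setT (Im \o @character R n).
Proof.
have := @measurable_cos_phase n (- (pi / 2)).
by apply: eq_measurable_fun => x _ /=; rewrite sin_cos.
Qed.

Lemma cL2_char n : cL2 (@character R n).
Proof.
apply: (@cL2_bounded _ 1); [exact: measurable_Re_char|exact: measurable_Im_char|].
by move=> x _; rewrite normc_char.
Qed.

Lemma Rint_cos_phase n (b : R) : n != 0 -> \int[haar2]_x cos (phase n x + b) = 0.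
Proof.
move=> n0.
have [] := @Rint_fubini (fun x => cos (phase n x + b)) 1.
- exact: measurable_cos_phase.
- by move=> x _; rewrite ler_norml cos_geN1 cos_le1.
have [m1|m1] := eqVneq n.1 0; last first.
  move=> _ ->; apply: haar_Rint_circle_eq0 => t _; rewrite -[RHS](cos_mean0
    (phase (0, n.2) (0, t) + b) m1).
  apply: eq_Rintegral => s _; congr cos; rewrite /phase /=; ring.
have n2 : n.2 != 0.
  by apply: contra n0 => /eqP n2; rewrite [n]surjective_pairing m1 n2.
move=> -> _; apply: haar_Rint_circle_eq0 => s _; rewrite -[RHS](cos_mean0
  (phase (n.1, 0) (s, 0) + b) n2).
apply: eq_Rintegral => t _; congr cos; rewrite /phase /=; ring.
Qed.

Lemma inner_char n k : inner (@character R n) (character k) = (n == k)%:R.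
Proof.
rewrite /inner (_ : (fun x => _) = character (n - k)); last first.
  by apply/funext => x; rewrite charD charN.
have [->|nk] := eqVneq n k.
  rewrite subrr (_ : character 0 = fun=> 1); last by apply/funext => x; rewrite char0.
  by apply: complexP; exact: Rint_cst.
have nk0 : n - k != 0 by rewrite subr_eq0.
apply: complexP => /=.
  rewrite -[RHS](Rint_cos_phase 0 nk0).
  by apply: eq_Rintegral => x _ /=; rewrite addr0.
rewrite -[RHS](Rint_cos_phase (- (pi / 2)) nk0).
by apply: eq_Rintegral => x _ /=; rewrite sin_cos.
Qed.

(** The trigonometric sum with frequencies [s] and coefficients [c]. *)
Definition trigsum (s : seq (int * int)) (c : int * int -> R[i]) : pt -> R[i] :=
  fun x => \sum_(n <- s) c n * character n x.

Lemma trigsum_nil c : trigsum [::] c = cst 0.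
Proof. by apply/funext => x; rewrite /trigsum big_nil. Qed.

Lemma trigsum_cons n s c : trigsum (n :: s) c = (fun x => c n * character n x) \+ trigsum s c.
Proof. by apply/funext => x; rewrite /trigsum big_cons. Qed.

Lemma cL2_0 : cL2 (cst 0 : pt -> R[i]).
Proof.
by have := cL2Z 0 (cL2_char 0); rewrite (_ : (fun x => _) = cst 0)//; apply/funext => x;
  rewrite mul0r.
Qed.

Lemma cL2_trigsum s c : cL2 (trigsum s c).
Proof.
elim: s => [|n s ih]; first by rewrite trigsum_nil; exact: cL2_0.
by rewrite trigsum_cons; apply: cL2D => //; apply: cL2Z; exact: cL2_char.
Qed.

Lemma inner0l f : inner (cst 0) f = 0.
Proof.
rewrite /inner /cintegral; apply: complexP => /=; under eq_Rintegral do rewrite mul0r;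
  exact: Rint_cst.
Qed.

Lemma inner_trigsuml s c f : cL2 f -> inner (trigsum s c) f = \sum_(n <- s) c n * (fourier f n)^*.
Proof.
move=> hf; elim: s => [|n s ih]; first by rewrite trigsum_nil big_nil inner0l.
have hc := cL2_char n.
rewrite trigsum_cons big_cons innerDl//; [|exact: cL2Z|exact: cL2_trigsum].
by rewrite innerZl// ih /fourier -innerC.
Qed.

Lemma inner_trigsumr s c f : cL2 f -> inner f (trigsum s c) = \sum_(n <- s) (c n)^* * fourier f n.
Proof.
move=> hf; rewrite innerC//; last exact: cL2_trigsum.
rewrite inner_trigsuml// rmorph_sum; apply: eq_bigr => n _.
by rewrite rmorphM /= conjCK.
Qed.

Lemma fourier_trigsum s c n : uniq s -> fourier (trigsum s c) n = if n \in s then c n else 0.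
Proof.
move=> us; rewrite /fourier inner_trigsuml; last exact: cL2_char.
rewrite /fourier; under eq_bigr do rewrite inner_char.
have [rnorm1star|rnorm1star] := boolP (n \in s).
  rewrite (bigD1_seq n)//= eqxx conjC1 mulr1 big1 ?addr0// => k /negbTE kn.
  by rewrite eq_sym kn conjC0 mulr0.
rewrite big_seq big1// => k ks; case: eqVneq => [e|_]; last by rewrite conjC0 mulr0.
by rewrite e ks in rnorm1star.
Qed.

Lemma sqnorm2_trigsum s c : uniq s -> sqnorm2 (trigsum s c) = \sum_(n <- s) normc (c n) ^+ 2.
Proof.
move=> us; apply: (@complexI R); rewrite -inner_self inner_trigsuml; last exact: cL2_trigsum.
rewrite rmorph_sum big_seq [RHS]big_seq; apply: eq_bigr => n rnorm1star.
by rewrite fourier_trigsum// rnorm1star mulcJ.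
Qed.

Lemma bessel s f : cL2 f -> uniq s -> \sum_(n <- s) normc (fourier f n) ^+ 2 <= sqnorm2 f.
Proof.
move=> hf us; set t := trigsum s (fourier f).
have ht : cL2 t by exact: cL2_trigsum.
have E : \sum_(n <- s) fourier f n * (fourier f n)^* = (\sum_(n <- s) normc (fourier f n) ^+ 2)%:C.
  by rewrite rmorph_sum; apply: eq_bigr => n _; rewrite mulcJ.
rewrite -subr_ge0 -lecR; have := inner_self (f \- t).
rewrite innerBl ?innerBr//; [|exact: cL2B].
rewrite inner_trigsumr// inner_trigsuml// -/t inner_self [inner t t]inner_self sqnorm2_trigsum// E.
under eq_bigr do rewrite mulrC; rewrite E subrr subr0 rmorphB => ->.
by rewrite lecR sqnorm2_ge0.
Qed.

Lemma eq_trigsum s c c' : {in s, c =1 c'} -> trigsum s c = trigsum s c'.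
Proof.
by move=> cc; apply/funext => x; rewrite /trigsum big_seq [RHS]big_seq; apply: eq_bigr => n /cc ->.
Qed.

Lemma trigsum_widen s s' c : uniq s -> uniq s' -> {subset s <= s'} ->
  (forall n, n \notin s -> c n = 0) -> trigsum s' c = trigsum s c.
Proof.
move=> us us' ss c0; apply/funext => x; rewrite /trigsum.
rewrite (bigID [in s]) /= [X in _ + X]big1 ?addr0; last by move=> n /c0 ->; rewrite mul0r.
rewrite -big_filter; apply: perm_big; apply: uniq_perm => //; first exact: filter_uniq.
by move=> n; rewrite mem_filter; case: (boolP (n \in s)) => //= /ss ->.
Qed.

(** A trigonometric polynomial is the sum of its Fourier series, over some
    duplicate-free list of frequencies. *)
Lemma trigpol_uniq p : @trigpol R p -> exists s, uniq s /\ p = trigsum s (fourier p).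
Proof.
move=> [s [c pE]]; pose c' n := c n *+ count_mem n s.
have e : p = trigsum (undup s) c'.
  apply/funext => x; rewrite pE /trigsum -[LHS]big_undup_iterop_count.
  apply: eq_bigr => n _; by rewrite /c' mulrnAl.
exists (undup s); split; first exact: undup_uniq.
rewrite [in RHS]e [LHS]e; apply: eq_trigsum => n rnorm1star.
by rewrite fourier_trigsum ?undup_uniq// rnorm1star.
Qed.

Lemma trigpol_trigsum s c : trigpol (trigsum s c).
Proof. by exists s, c. Qed.

Lemma trigpol_cL2 p : @trigpol R p -> cL2 p.
Proof. by move=> /trigpol_uniq[s [_ ->]]; exact: cL2_trigsum. Qed.

Lemma trigpol_char n : trigpol (@character R n).
Proof. by exists [:: n], (fun=> 1) => x; rewrite big_seq1 mul1r. Qed.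

Lemma trigpolZ (c : R[i]) p : trigpol p -> trigpol (fun x => c * p x).
Proof.
move=> [s [d pE]]; exists s, (fun n => c * d n) => x.
by rewrite pE mulr_sumr; apply: eq_bigr => n _; rewrite mulrA.
Qed.

(** The list of frequencies can be enlarged, so that two trigonometric polynomials can
    be expanded over a common list. *)
Lemma trigpol_repr p : @trigpol R p -> exists s, uniq s /\ forall s', uniq s' -> {subset s <= s'} ->
  p = trigsum s' (fourier p).
Proof.
move=> /trigpol_uniq[s [us pE]]; exists s; split => // s' us' ss.
rewrite [LHS]pE; apply/esym/trigsum_widen => // n rnorm1star.
by rewrite pE fourier_trigsum// (negbTE rnorm1star).
Qed.

Lemma trigpolD p q : @trigpol R p -> trigpol q -> trigpol (p \+ q).
Proof.
move=> /trigpol_repr[s [us ps]] /trigpol_repr[s' [us' qs]].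
pose S := undup (s ++ s'); have uS : uniq S by exact: undup_uniq.
exists S, (fun n => fourier p n + fourier q n) => x /=.
have h1 : {subset s <= S} by move=> n rnorm1star; rewrite mem_undup mem_cat rnorm1star.
have h2 : {subset s' <= S} by move=> n rnorm1star; rewrite mem_undup mem_cat rnorm1star orbT.
apply: (etrans (f_equal2 +%R (congr1 (@^~ x) (ps S uS h1)) (congr1 (@^~ x) (qs S uS h2)))).
by rewrite /trigsum -big_split /=; apply: eq_bigr => n _; rewrite mulrDl.
Qed.

Lemma trigpol_cst (c : R[i]) : trigpol (fun _ : pt => c).
Proof.
have := trigpolZ c (trigpol_char 0); rewrite (_ : (fun x => _) = fun=> c)//.
by apply/funext => x; rewrite char0 mulr1.
Qed.

Lemma trigpol_sum (I : Type) (r : seq I) (P : I -> pt -> R[i]) :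
  (forall i, trigpol (P i)) -> trigpol (fun x => \sum_(i <- r) P i x).
Proof.
move=> hP; elim: r => [|i r ih].
  by under eq_fun do rewrite big_nil; exact: trigpol_cst.
by under eq_fun do rewrite big_cons; exact: trigpolD.
Qed.

Lemma trigpolM p q : @trigpol R p -> trigpol q -> trigpol (fun x => p x * q x).
Proof.
move=> [s [c pE]] [s' [c' qE]].
rewrite (_ : (fun x => _) = fun x => \sum_(n <- s) c n * \sum_(k <- s') c' k * character (n + k) x).
  by apply: trigpol_sum => n; apply: trigpolZ; apply: trigpol_sum => k; apply: trigpolZ;
    exact: trigpol_char.
apply/funext => x; rewrite pE qE mulr_suml; apply: eq_bigr => n _.
rewrite -mulrA; congr (_ * _); rewrite mulr_sumr; apply: eq_bigr => k _.
by rewrite charD mulrCA.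
Qed.

Lemma trigpolJ p : @trigpol R p -> trigpol (fun x => (p x)^*).
Proof.
move=> [s [c pE]].
rewrite (_ : (fun x => _) = fun x => \sum_(n <- s) (c n)^* * character (- n) x).
  by apply: trigpol_sum => n; apply: trigpolZ; exact: trigpol_char.
by apply/funext => x; rewrite pE rmorph_sum; apply: eq_bigr => n _; rewrite rmorphM /= charN.
Qed.

Lemma trigpolN p : @trigpol R p -> trigpol (\- p).
Proof.
by move/(trigpolZ (-1)); rewrite (_ : (fun x => _) = \- p)//; apply/funext => x; rewrite mulN1r.
Qed.

Lemma trigpolB p q : @trigpol R p -> trigpol q -> trigpol (p \- q).
Proof. by move=> hp /trigpolN; exact: trigpolD. Qed.

(** * The projection P_+ on trigonometric polynomials *)

(** The positive cone as a boolean predicate. *)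
Definition Xplusb (n : int * int) : bool := `[< Xplus n >].

(** A duplicate-free list of frequencies over which a trigonometric polynomial is the sum
    of its Fourier series; it is selected by choice, and may contain frequencies whose
    coefficient vanishes. *)
Definition spectrum (p : pt -> R[i]) : seq (int * int) :=
  xget [::] [set s | uniq s /\ p = trigsum s (fourier p)].

Lemma spectrumP p : trigpol p -> uniq (spectrum p) /\ p = trigsum (spectrum p) (fourier p).
Proof. by move=> /trigpol_uniq[s hs]; rewrite /spectrum; case: xgetP => [? _ //|/(_ s)]. Qed.

(** The explicit projection of a trigonometric polynomial onto its nonnegative
    frequencies. *)
Definition proj_plus (p : pt -> R[i]) : pt -> R[i] := trigsum [seq n <- spectrum p | Xplusb n]
  (fourier p).

Lemma trigpol_proj_plus p : trigpol (proj_plus p). Proof. exact: trigpol_trigsum. Qed.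

Lemma fourier_spectrum p n : trigpol p -> n \notin spectrum p -> fourier p n = 0.
Proof. by move=> /spectrumP[us pE] rnorm1star; rewrite pE fourier_trigsum// (negbTE rnorm1star).
  Qed.

Lemma fourier_proj_plus p n : trigpol p -> fourier (proj_plus p) n = if Xplusb n then fourier p n
  else 0.
Proof.
move=> hp; have [us pE] := spectrumP hp.
rewrite fourier_trigsum ?filter_uniq// mem_filter; case: ifP => [/andP[->]//|].
by case: (Xplusb n) => //= /negbT/(fourier_spectrum hp) ->.
Qed.

Lemma trigpol_inj p q : trigpol p -> trigpol q -> (forall n, fourier p n = fourier q n) -> p = q.
Proof.
move=> /trigpol_repr[s [us ps]] /trigpol_repr[s' [us' qs]] pq.
pose S := undup (s ++ s'); have uS : uniq S by exact: undup_uniq.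
have h1 : {subset s <= S} by move=> n rnorm1star; rewrite mem_undup mem_cat rnorm1star.
have h2 : {subset s' <= S} by move=> n rnorm1star; rewrite mem_undup mem_cat rnorm1star orbT.
rewrite (ps S uS h1) (qs S uS h2); apply: eq_trigsum => n _; exact: pq.
Qed.

Lemma fourierD f g n : cL2 f -> cL2 g -> fourier (f \+ g) n = fourier f n + fourier g n.
Proof. by move=> hf hg; apply: innerDl => //; exact: cL2_char. Qed.
Lemma fourierN f n : cL2 f -> fourier (\- f) n = - fourier f n.
Proof. by move=> hf; apply: innerNl => //; exact: cL2_char. Qed.
Lemma fourierB f g n : cL2 f -> cL2 g -> fourier (f \- g) n = fourier f n - fourier g n.
Proof. by move=> hf hg; apply: innerBl => //; exact: cL2_char. Qed.

Lemma proj_plusN p : trigpol p -> proj_plus (\- p) = \- proj_plus p.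
Proof.
move=> hp; apply: trigpol_inj; [exact: trigpol_proj_plus|exact/trigpolN/trigpol_proj_plus|move=> n].
rewrite fourierN; last exact/trigpol_cL2/trigpol_proj_plus.
rewrite !fourier_proj_plus//; last exact: trigpolN.
by case: (Xplusb n); rewrite ?oppr0 ?fourierN//; exact: trigpol_cL2.
Qed.

Lemma proj_plusD p q : trigpol p -> trigpol q -> proj_plus (p \+ q) = proj_plus p \+ proj_plus q.
Proof.
move=> hp hq; apply: trigpol_inj; [exact: trigpol_proj_plus|exact/trigpolD/trigpol_proj_plus/trigpol_proj_plus|move=> n].
rewrite fourierD; [|exact/trigpol_cL2/trigpol_proj_plus..].
rewrite !fourier_proj_plus//; last exact: trigpolD.
by case: (Xplusb n); rewrite ?addr0 ?fourierD//; exact: trigpol_cL2.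
Qed.

Lemma proj_plusB p q : trigpol p -> trigpol q -> proj_plus (p \- q) = proj_plus p \- proj_plus q.
Proof. by move=> hp hq; rewrite proj_plusD ?proj_plusN//; exact: trigpolN. Qed.

Lemma inner_trigpoll p f : trigpol p -> cL2 f ->
  inner p f = \sum_(n <- spectrum p) fourier p n * (fourier f n)^*.
Proof. by move=> /spectrumP[us pE] hf; rewrite {1}pE inner_trigsuml. Qed.

Lemma H2_proj_plus p : trigpol p -> H2 (proj_plus p).
Proof.
move=> hp; split; first exact/trigpol_cL2/trigpol_proj_plus.
by move=> n Xn; rewrite fourier_proj_plus// /Xplusb asboolF.
Qed.

Lemma proj_plus_orth p h : trigpol p -> H2 h -> inner (p \- proj_plus p) h = 0.
Proof.
move=> hp [ch hh]; rewrite inner_trigpoll//; last exact/trigpolB/trigpol_proj_plus.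
rewrite big1// => n _; rewrite fourierB; [|exact: trigpol_cL2|exact/trigpol_cL2/trigpol_proj_plus].
rewrite fourier_proj_plus//; case: ifPn => [_|]; first by rewrite subrr mul0r.
by move=> /asboolPn/hh ->; rewrite conjC0 mulr0.
Qed.

Lemma H2B f g : H2 f -> H2 g -> H2 (f \- g).
Proof.
move=> [cf hf] [cg hg]; split; first exact: cL2B.
by move=> n Xn; rewrite fourierB// hf// hg// subrr.
Qed.

(** The orthogonal projection selected by choice in [Pplus] agrees, up to a function of
    zero L2 norm, with the explicit truncation of the frequencies: both are in H2 and the
    difference is orthogonal to itself. *)
Lemma Pplus_trigpol p : trigpol p -> cL2 (Pplus p) /\ sqnorm2 (Pplus p \- proj_plus p) = 0.
Proof.
move=> hp; have cp := trigpol_cL2 hp.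
rewrite /Pplus; case: xgetP => [g _ [Hg og]|/(_ (proj_plus p))]; last first.
  by case; split; [exact: H2_proj_plus|move=> h Hh; exact: proj_plus_orth].
split; first by case: Hg.
have cg : cL2 g by case: Hg.
have cP : cL2 (proj_plus p) by exact/trigpol_cL2/trigpol_proj_plus.
have Hd := H2B Hg (H2_proj_plus hp); have cd : cL2 (g \- proj_plus p) by case: Hd.
apply: (@complexI R); rewrite -inner_self.
have e : g \- proj_plus p = (p \- proj_plus p) \- (p \- g).
  by apply/funext => x /=; ring.
rewrite {1}e innerBl//; [|exact: cL2B..].
by rewrite proj_plus_orth// og// subrr.
Qed.

(** The norm [norm1star] of a trigonometric polynomial, as a real number. *)
Definition rnorm1star (p : pt -> R[i]) : R := rnorm1 (p \- proj_plus p) + rnorm1 (proj_plus p).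

Lemma norm1star_rnorm1star (q : pt -> R) : real_trigpol q -> norm1star q = (rnorm1star (cplx q))%:E.
Proof.
move=> hq; have cq := trigpol_cL2 hq; have [cP P0] := Pplus_trigpol hq.
have cP' : cL2 (proj_plus (cplx q)) by exact/trigpol_cL2/trigpol_proj_plus.
rewrite /norm1star /Pminus !cnorm1E; [|exact: cL2_cL1|exact/cL2_cL1/cL2B].
rewrite /rnorm1star EFinD; congr (_ + _)%E; congr EFin; apply: rnorm1_eq => //;
  [exact: cL2B|exact: cL2B|].
rewrite sqnorm2BC (_ : _ \- _ = Pplus (cplx q) \- proj_plus (cplx q))//.
by apply/funext => x /=; ring.
Qed.

Lemma rnorm1starN p : trigpol p -> rnorm1star (\- p) = rnorm1star p.
Proof.
move=> hp; rewrite /rnorm1star proj_plusN// rnorm1N; congr (_ + _).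
by rewrite -rnorm1N; congr rnorm1; apply/funext => x /=; rewrite opprB opprK addrC.
Qed.

Lemma rnorm1starD_le p q : trigpol p -> trigpol q -> rnorm1star (p \+ q) <= rnorm1star p +
  rnorm1star q.
Proof.
move=> hp hq; rewrite /rnorm1star proj_plusD// addrACA; have tP r := trigpol_proj_plus r.
apply: lerD; last by apply: rnorm1D_le; exact/cL2_cL1/trigpol_cL2.
rewrite (_ : _ \- _ = (p \- proj_plus p) \+ (q \- proj_plus q)).
  by apply: rnorm1D_le; exact/cL2_cL1/trigpol_cL2/trigpolB.
by apply/funext => x /=; rewrite opprD addrACA.
Qed.

Lemma rnorm1star_leB p q : trigpol p -> trigpol q -> rnorm1star p <=
  rnorm1star q + rnorm1star (p \- q).
Proof.
move=> hp hq; have := rnorm1starD_le hq (trigpolB hp hq).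
by rewrite (_ : q \+ _ = p)//; apply/funext => x /=; rewrite addrC subrK.
Qed.

Lemma sqnorm2_trigpol_le p f : trigpol p -> cL2 f ->
  (forall n, normc (fourier p n) <= normc (fourier f n)) -> sqnorm2 p <= sqnorm2 f.
Proof.
move=> /spectrumP[us pE] hf h; rewrite pE sqnorm2_trigsum//; apply: (le_trans _ (bessel hf us)).
by apply: ler_sum => n _; rewrite lerXn2r ?nnegrE ?normc_ge0.
Qed.

Lemma sqnorm2_proj_plus p : trigpol p -> sqnorm2 (proj_plus p) <= sqnorm2 p.
Proof.
move=> hp; apply: sqnorm2_trigpol_le; [exact: trigpol_proj_plus|exact: trigpol_cL2|move=> n].
by rewrite fourier_proj_plus//; case: ifP => // _; rewrite normc0 normc_ge0.
Qed.

Lemma sqnorm2_proj_minus p : trigpol p -> sqnorm2 (p \- proj_plus p) <= sqnorm2 p.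
Proof.
move=> hp; have cp := trigpol_cL2 hp.
apply: sqnorm2_trigpol_le => //; [exact/trigpolB/trigpol_proj_plus|move=> n].
rewrite fourierB//; last exact/trigpol_cL2/trigpol_proj_plus.
by rewrite fourier_proj_plus//; case: ifP => _; rewrite ?subr0// subrr normc0 normc_ge0.
Qed.

(** On trigonometric polynomials the norm is dominated by the L2 norm. *)
Lemma rnorm1star_small p (e : R) : trigpol p -> 0 < e -> sqnorm2 p <= e ^+ 2 -> rnorm1star p <=
  2 * e.
Proof.
move=> hp e0 he; rewrite mulr_natl mulr2n; apply: lerD; apply: rnorm1_small => //.
- exact/trigpol_cL2/trigpolB/trigpol_proj_plus.
- exact: le_trans (sqnorm2_proj_minus hp) he.
- exact/trigpol_cL2/trigpol_proj_plus.
- exact: le_trans (sqnorm2_proj_plus hp) he.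
Qed.

(** * Polynomial approximation of the sign of a trigonometric polynomial *)

(** Polynomials [r_k] with [s * r_k s] the classical iterates
    [p_(k+1) = p_k + (s - p_k ^ 2) / 2], starting from [0], that converge to the square
    root of [s] on [[0, 1]].  They are divided by [s], so that [r_k] approximates the
    inverse square root and [t * r_k (t ^ 2)] the sign of [t]. *)
Fixpoint rsqrt_poly (k : nat) (s : R) : R :=
  if k is k'.+1 then rsqrt_poly k' s + (1 - s * rsqrt_poly k' s ^+ 2) / 2 else 0.

(** With [y = t * r_k (t ^ 2)], the second estimate gives both the uniform bound
    [t * (1 - y) <= 2 / k] and the convergence of [y] to [1] when [t > 0]. *)
Lemma rsqrt_poly_bound k (t : R) : 0 <= t <= 1 ->
  0 <= t * rsqrt_poly k (t ^+ 2) <= 1 /\ (1 - t * rsqrt_poly k (t ^+ 2)) * (2 + k%:R * t) <= 2.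
Proof.
move=> /andP[t0 t1]; elim: k => [|k [/andP[y0 y1] ih]] /=.
  by rewrite mulr0 lexx ler01 subr0 mul1r mul0r addr0.
set y := t * rsqrt_poly k (t ^+ 2) in y0 y1 ih *.
have -> : t * (rsqrt_poly k (t ^+ 2) + (1 - t ^+ 2 * rsqrt_poly k (t ^+ 2) ^+ 2) / 2) = y + t *
  (1 - y ^+ 2) / 2.
  by rewrite /y; field.
have e : 1 - (y + t * (1 - y ^+ 2) / 2) = (1 - y) * (1 - t * (1 + y) / 2) by field.
have h1 : 0 <= 1 - t * (1 + y) / 2 by nra.
have ub : y + t * (1 - y ^+ 2) / 2 <= 1 by rewrite -subr_ge0 e mulr_ge0// subr_ge0.
split.
  by rewrite ub andbT addr_ge0// divr_ge0// mulr_ge0// subr_ge0 expr_le1.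
rewrite e; apply: le_trans ih; rewrite -mulrA; apply: ler_wpM2l; first by rewrite subr_ge0.
rewrite -[k.+1%:R]natr1.
have k0 : 0 <= k%:R :> R by [].
have h2 : 1 - t * (1 + y) / 2 <= 1 - t / 2 by nra.
have d0 : 0 <= 2 + (k%:R + 1) * t by rewrite addr_ge0// mulr_ge0// addr_ge0.
apply: (le_trans (ler_wpM2r d0 h2)).
rewrite -subr_ge0 (_ : _ - _ = t ^+ 2 * (k%:R + 1) / 2); last by field.
by rewrite divr_ge0// mulr_ge0 ?sqr_ge0// addr_ge0.
Qed.

Lemma cplxD (u v : pt -> R) : cplx (u \+ v) = cplx u \+ cplx v.
Proof. by apply/funext => x; rewrite /cplx /= rmorphD. Qed.
Lemma cplxB (u v : pt -> R) : cplx (u \- v) = cplx u \- cplx v.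
Proof. by apply/funext => x; rewrite /cplx /= rmorphB. Qed.
Lemma cplxN (u : pt -> R) : cplx (\- u) = \- cplx u.
Proof. by apply/funext => x; rewrite /cplx /= rmorphN. Qed.

Lemma real_trigpolD u v : @real_trigpol R u -> real_trigpol v -> real_trigpol (u \+ v).
Proof. by rewrite /real_trigpol cplxD; exact: trigpolD. Qed.
Lemma real_trigpolB u v : @real_trigpol R u -> real_trigpol v -> real_trigpol (u \- v).
Proof. by rewrite /real_trigpol cplxB; exact: trigpolB. Qed.
Lemma real_trigpolM u v : @real_trigpol R u -> real_trigpol v -> real_trigpol (fun x => u x * v x).
Proof.
move=> hu hv; rewrite /real_trigpol (_ : cplx _ = fun x => cplx u x * cplx v x);
  first exact: trigpolM.
by apply/funext => x; rewrite /cplx rmorphM.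
Qed.
Lemma real_trigpol_cst (c : R) : real_trigpol (fun _ : pt => c).
Proof. exact: trigpol_cst. Qed.

Lemma real_trigpol_rsqrt_poly k u : @real_trigpol R u -> real_trigpol (fun x => rsqrt_poly k (u x)).
Proof.
move=> hu; elim: k => [|k ih] /=; first exact: real_trigpol_cst.
apply: real_trigpolD => //; apply: (real_trigpolM _ (real_trigpol_cst _)).
apply: real_trigpolB; first exact: real_trigpol_cst.
by apply: real_trigpolM => //; exact: real_trigpolM.
Qed.

Lemma trigpol_bounded p : @trigpol R p -> exists2 B : R, 0 < B & forall x, normc (p x) <= B.
Proof.
move=> [s [c pE]]; exists (1 + \sum_(n <- s) normc (c n)).
  by rewrite ltr_pwDl// sumr_ge0// => n _; exact: normc_ge0.
move=> x; rewrite pE; apply: (@le_trans _ _ (\sum_(n <- s) normc (c n))); last by rewrite lerDr.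
elim: s {pE} => [|n s ih]; first by rewrite !big_nil normc0.
rewrite !big_cons (le_trans (le_normcD _ _))//.
by rewrite lerD// normcM normc_char mulr1.
Qed.

(** A polynomial substitute for [g / |g|]: the trigonometric polynomial
    [z * r_k (|z| ^ 2)], where [z] is [g] divided by a bound of its modulus. *)
Lemma unimodular_approx g (e : R) : trigpol g -> 0 < e -> exists p, [/\ trigpol p,
  forall x, normc (p x) <= 1 & forall x, normc (g x) <= Re (g x * (p x)^*) + e].
Proof.
move=> hg e0; have [B B0 gB] := trigpol_bounded hg.
pose u : pt -> R := fun x => normc (B^-1%:C * g x) ^+ 2.
have hu : real_trigpol u.
  rewrite /real_trigpol (_ : cplx u = fun x => (B^-1%:C * g x) * (B^-1%:C * g x)^*).
    by apply: trigpolM; [|apply: trigpolJ]; exact: trigpolZ.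
  by apply/funext => x; rewrite mulcJ.
have [k k_gt0 ke] : exists2 k : nat, (0 < k)%N & 2 * B / e <= k%:R.
  by exists (Num.truncn (2 * B / e)).+1; rewrite // ltW// truncnS_gt.
exists (fun x => B^-1%:C * g x * (rsqrt_poly k (u x))%:C); split.
- by apply: trigpolM; [exact: trigpolZ|exact: real_trigpol_rsqrt_poly].
- move=> x; set z := B^-1%:C * g x.
  have z1 : 0 <= normc z <= 1.
    rewrite normc_ge0 normcM normc_real ger0_norm ?invr_ge0 ?(ltW B0)//=.
    by rewrite mulrC ler_pdivrMr// mul1r.
  have [/andP[y0 y1] _] := rsqrt_poly_bound k z1.
  by rewrite normcM normc_real -{1}(ger0_norm (normc_ge0 z)) -normrM ger0_norm.
- move=> x; set z := B^-1%:C * g x.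
  have z1 : 0 <= normc z <= 1.
    rewrite normc_ge0 normcM normc_real ger0_norm ?invr_ge0 ?(ltW B0)//=.
    by rewrite mulrC ler_pdivrMr// mul1r.
  have [/andP[y0 y1] yk] := rsqrt_poly_bound k z1.
  have gE : g x = B%:C * z by rewrite /z mulrA -rmorphM /= divff ?gt_eqF// rmorph1 mul1r.
  rewrite [X in Re X](_ : _ = (B * normc z ^+ 2 * rsqrt_poly k (u x))%:C) /=; last first.
    rewrite gE rmorphM /= -mulrA [z * _]mulrA mulcJ !rmorphM /= -!mulrA; congr (_ * (_ * _)).
    by apply: complexP; rewrite ?ReJ ?ImJ//= oppr0.
  rewrite [X in normc X]gE normcM normc_real (ger0_norm (ltW B0)).
  set t := normc z in z1 y0 y1 yk *; rewrite -/t.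
  have -> : u x = t ^+ 2 by [].
  set r := rsqrt_poly k (t ^+ 2) in y0 y1 yk *.
  have [t0 t1] := andP z1.
  have k0 : 0 < k%:R :> R by rewrite ltr0n.
  have h : (1 - t * r) * (k%:R * t) <= 2.
    by apply: le_trans yk; rewrite ler_wpM2l ?subr_ge0// lerDr.
  have hB : 2 * B <= e * k%:R by move: ke; rewrite ler_pdivrMr// [e * _]mulrC.
  rewrite -lerBlDl (_ : _ - _ = B * (t * (1 - t * r))); last by ring.
  rewrite -(ler_pM2r k0); apply: le_trans hB.
  rewrite -mulrA [2 * B]mulrC; apply: ler_wpM2l; first exact: ltW.
  by apply: le_trans h; rewrite le_eqVlt; apply/orP; left; apply/eqP; ring.
Qed.

(** * The norm of the completion is well defined *)

Lemma Re_inner_le f g (B : R) : cL2 f -> cL2 g -> (forall x, normc (g x) <= B) ->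
  Re (inner f g) <= B * rnorm1 f.
Proof.
move=> hf hg gB; have hn := cL1_normc (cL2_cL1 hf).
rewrite /rnorm1 -RintZ//; apply: Rint_le; [by case: (cL1_inner hf hg)|exact: (Lfun1Z B hn)|].
move=> x _; apply: (le_trans (ler_norm _)); apply: (le_trans (le_Re_normc _)).
by rewrite normcM normc_conj mulrC ler_wpM2r ?normc_ge0.
Qed.

(** The L1 norm of a trigonometric polynomial is tested by trigonometric polynomials
    bounded by one. *)
Lemma rnorm1_dual_approx g (e : R) : trigpol g -> 0 < e -> exists p, [/\ trigpol p,
  forall x, normc (p x) <= 1 & rnorm1 g <= Re (inner g p) + e].
Proof.
move=> hg e0; have [p [hp p1 gp]] := unimodular_approx hg e0; exists p; split => //.
have cg := trigpol_cL2 hg; have cp := trigpol_cL2 hp.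
have [hr _] := cL1_inner cg cp.
rewrite /inner /= -[X in _ + X]Rint_cst -RintD//; last exact: Lfun1_cst.
apply: Rint_le; [exact/cL1_normc/cL2_cL1|apply: (Lfun1D hr); exact: Lfun1_cst|].
by move=> x _; exact: gp.
Qed.

Lemma proj_plus_selfadj p q : trigpol p -> trigpol q -> inner (proj_plus p) q = inner p
  (proj_plus q).
Proof.
move=> hp hq.
have [cp cq cP cQ] : [/\ cL2 p, cL2 q, cL2 (proj_plus p) & cL2 (proj_plus q)].
  by split; apply: trigpol_cL2 => //; exact: trigpol_proj_plus.
have e1 := proj_plus_orth hp (H2_proj_plus hq); have e2 := proj_plus_orth hq (H2_proj_plus hp).
move: e1; rewrite innerBl// => /eqP; rewrite subr_eq0 => /eqP ->.
move: e2; rewrite innerC; [|by []|exact: cL2B].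
move=> /(congr1 (fun z => z^*)); rewrite conjCK conjC0 innerBr// => /eqP.
by rewrite subr_eq0 => /eqP ->.
Qed.

(** Convergence to zero, for sequences of nonnegative reals. *)
Definition vanishing (u : nat -> R) := forall e : R, 0 < e ->
  exists N, forall n, (N <= n)%N -> u n <= e.

Lemma le_three_thirds (a b e : R) : a - b <= e / 3 -> b <= e / 3 -> a + e / 3 <= e.
Proof. by move=> ? ?; lra. Qed.

(** If the projections are Cauchy in L1 and the polynomials tend to zero in L1, then so do
    the projections.  Their frequencies are not bounded uniformly, hence the passage
    through duality: tested on a fixed trigonometric polynomial, the projections do tend
    to zero. *)
Lemma proj_plus_vanishing (d : nat -> pt -> R[i]) : (forall n, trigpol (d n)) ->
  (forall e : R, 0 < e -> exists N, forall m n, (N <= m)%N -> (N <= n)%N ->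
     rnorm1 (proj_plus (d m) \- proj_plus (d n)) <= e) ->
  vanishing (fun n => rnorm1 (d n)) -> vanishing (fun n => rnorm1 (proj_plus (d n))).
Proof.
move=> hd hc d0 e e0; have e3 : 0 < e / 3 by rewrite divr_gt0.
have [N hN] := hc _ e3; exists N => n Nn.
have [p [hp p1 gp]] := rnorm1_dual_approx (trigpol_proj_plus (d n)) e3.
have [B B0 pB] := trigpol_bounded (trigpol_proj_plus p).
have [N' hN'] := d0 _ (divr_gt0 e3 B0).
pose m := maxn N N'.
have h1 : rnorm1 (proj_plus (d n) \- proj_plus (d m)) <= e / 3 by apply: hN => //; exact: leq_maxl.
have h2 : rnorm1 (d m) <= e / 3 / B by apply: hN'; exact: leq_maxr.
have [cn cm cp cdm cP] : [/\ cL2 (proj_plus (d n)), cL2 (proj_plus (d m)), cL2 p, cL2 (d m) &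
  cL2 (proj_plus p)].
  by split; apply: trigpol_cL2 => //; exact: trigpol_proj_plus.
have i1 : Re (inner (proj_plus (d n) \- proj_plus (d m)) p) <= e / 3.
  by apply: le_trans h1; rewrite -[leRHS]mul1r; apply: Re_inner_le => //; exact: cL2B.
(* The projection is moved to the fixed, hence bounded, test polynomial. *)
have i2 : Re (inner (proj_plus (d m)) p) <= e / 3.
  rewrite proj_plus_selfadj//; apply: (le_trans (Re_inner_le cdm cP pB)).
  by rewrite mulrC -ler_pdivlMr.
apply: (le_trans gp); rewrite innerBl// in i1.
move: i1 i2; rewrite (_ : Re (_ - _) = Re (inner (proj_plus (d n)) p) - Re
  (inner (proj_plus (d m)) p)).
  exact: le_three_thirds.
by case: (inner _ _) => a b; case: (inner _ _).
Qed.

Lemma rnorm1star_le_rnorm1 p : trigpol p -> rnorm1star p <= rnorm1 p + 2 * rnorm1 (proj_plus p).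
Proof.
move=> hp; have cp := trigpol_cL2 hp; have cP := trigpol_cL2 (trigpol_proj_plus p).
rewrite /rnorm1star mulr_natl mulr2n addrA lerD2r.
by have := rnorm1D_le (cL2_cL1 cp) (cL2_cL1 (cL2N cP)); rewrite rnorm1N.
Qed.

Lemma rnorm1star_vanishing (d : nat -> pt -> R[i]) : (forall n, trigpol (d n)) ->
  (forall e : R, 0 < e -> exists N, forall m n, (N <= m)%N -> (N <= n)%N ->
    rnorm1star (d m \- d n) <= e) ->
  vanishing (fun n => rnorm1 (d n)) -> vanishing (fun n => rnorm1star (d n)).
Proof.
move=> hd hc d0 e e0; have e3 : 0 < e / 3 by rewrite divr_gt0.
have [|N hN] := proj_plus_vanishing hd _ d0 e3.
  move=> e' /hc[N hN]; exists N => m n Nm Nn; apply: le_trans (hN _ _ Nm Nn).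
  by rewrite -proj_plusB// /rnorm1star lerDr rnorm1_ge0.
have [N' hN'] := d0 _ e3; exists (maxn N N') => n; rewrite geq_max => /andP[Nn N'n].
by have := rnorm1star_le_rnorm1 (hd n); have := hN _ Nn; have := hN' _ N'n => /= a b c; lra.
Qed.

Lemma cL1_cplx (u : pt -> R) : u \in L1 -> cL1 (cplx u).
Proof. by move=> hu; split => //; exact: Lfun1_cst. Qed.

Lemma cL2_cplx (u : pt -> R) : u \in L2 -> cL2 (cplx u).
Proof. by move=> hu; apply/cL2P; split => //; exact: Lfun_cst. Qed.

Lemma norm1E (u : pt -> R) : u \in L1 -> norm1 u = (rnorm1 (cplx u))%:E.
Proof.
move=> hu; rewrite -cnorm1E; last exact: cL1_cplx.
rewrite /cnorm1 /norm1 -[LHS]Lnorm_abse; congr Lnorm.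
by apply/funext => x; rewrite /comp /cplx normc_real.
Qed.

Lemma real_trigpol_L1 u : @real_trigpol R u -> u \in L1.
Proof. by move=> /trigpol_cL2/cL2_cL1[]. Qed.

Lemma vanishing_cvg (u : nat -> R) : (forall n, 0 <= u n) -> vanishing u <->
  ((fun n => (u n)%:E) @ \oo --> (0%:E : \bar R)).
Proof.
move=> u0; split=> [h|/fine_cvgP[_ /cvgrPdist_le h] e e0].
  apply: cvg_EFin; first exact: nearW.
  apply/cvgrPdist_le => e /h[N hN]; near=> n.
  rewrite sub0r normrN ger0_norm//; apply: hN; near: n; exact: nbhs_infty_ge.
have [N _ hN] := h _ e0; exists N => n Nn; have := hN n Nn.
by rewrite /= sub0r normrN ger0_norm.
Unshelve. all: by end_near. Qed.

(** Convergence of a real sequence, in terms of [vanishing]. *)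
Definition tends_to (u : nat -> R) (l : R) := vanishing (fun n => `|u n - l|).

Lemma tends_to_EFin (u : nat -> R) (l : R) : tends_to u l -> (fun n => (u n)%:E) @ \oo --> l%:E.
Proof.
move=> h; apply: cvg_EFin; first exact: nearW.
apply/cvgrPdist_le => e /h[N hN]; near=> n.
rewrite distrC; apply: hN; near: n; exact: nbhs_infty_ge.
Unshelve. all: by end_near. Qed.

Lemma tends_to_exists (u : nat -> R) :
  (forall e : R, 0 < e -> exists N, forall m n, (N <= m)%N -> (N <= n)%N -> u m - u n <= e) ->
  exists l, tends_to u l.
Proof.
move=> hc; have : cvgn u.
  apply/cauchy_cvgP/cauchy_exP => e e0.
  have [N hN] := hc (e / 2) (divr_gt0 e0 (ltr0Sn _ 1)); exists (u N); exists N => // n Nn.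
  rewrite /= -ball_normE /=.
  apply: (@le_lt_trans _ _ (e / 2)); last by rewrite ltr_pdivrMr// mulr_natr mulr2n ltrDl.
  by rewrite ler_norml lerNl opprB !hN//=.
move=> /cvg_ex[l /cvgrPdist_le hl]; exists l => e e0.
by have [N _ hN] := hl _ e0; exists N => n Nn; rewrite distrC; exact: hN.
Qed.

Lemma represents_vanishing (q : (pt -> R)^nat) (f : pt -> R) : f \in L1 -> represents q f ->
  vanishing (fun n => rnorm1 (cplx f \- cplx (q n))).
Proof.
move=> hf [hq _ hl]; apply/vanishing_cvg; first by move=> n; exact: rnorm1_ge0.
move: hl; apply: cvg_trans; apply: near_eq_cvg; apply: nearW => n.
rewrite -cplxB norm1E//; apply: Lfun1D => //; apply: Lfun1N; exact: real_trigpol_L1.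
Qed.

Lemma represents_cauchy (q : (pt -> R)^nat) (f : pt -> R) : represents q f ->
  forall e : R, 0 < e -> exists N, forall m n, (N <= m)%N -> (N <= n)%N ->
    rnorm1star (cplx (q m) \- cplx (q n)) <= e.
Proof.
move=> [hq hc _] e /hc[N hN]; exists N => m n Nm Nn.
have := hN _ _ Nm Nn; rewrite norm1star_rnorm1star ?lee_fin; last exact: real_trigpolB.
by rewrite cplxB.
Qed.

Lemma dist_le_halves (x y l d e : R) : x <= y + d -> y <= x + d -> d <= e / 2 ->
  `|y - l| <= e / 2 -> `|x - l| <= e.
Proof. by rewrite !ler_norml => ? ? ? /andP[? ?]; apply/andP; split; lra. Qed.

(** The norm of the completion can be computed along any representing sequence: the
    difference of two of them is Cauchy and vanishes in L1, hence vanishes for the norm. *)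
Lemma H1R_norm_represents (q : (pt -> R)^nat) (f : pt -> R) : f \in L1 -> represents q f ->
  exists l, tends_to (fun n => rnorm1star (cplx (q n))) l /\ H1R_norm f = l%:E.
Proof.
move=> hf hq.
have lim (q' : (pt -> R)^nat) : represents q' f -> exists l, tends_to
  (fun n => rnorm1star (cplx (q' n))) l.
  move=> hq'; apply: tends_to_exists => e /(represents_cauchy hq')[N hN]; exists N => m n Nm Nn.
  have [tq _ _] := hq'; apply: le_trans (hN _ _ Nm Nn).
  by rewrite lerBlDl; apply: rnorm1star_leB; exact: tq.
have [l hl] := lim _ hq; exists l; split => //.
have E (q' : (pt -> R)^nat) : represents q' f -> (fun n => norm1star (q' n)) =
  (fun n => (rnorm1star (cplx (q' n)))%:E).
  by move=> [tq _ _]; apply/funext => n; rewrite norm1star_rnorm1star.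
rewrite /H1R_norm; case: xgetP => [r _ [q' hq' hr]|/(_ l%:E)]; last first.
  by case; exists q => //; rewrite E//; exact: tends_to_EFin.
have [tq _ _] := hq; have [tq' _ _] := hq'.
have hd : vanishing (fun n => rnorm1star (cplx (q n) \- cplx (q' n))).
  apply: rnorm1star_vanishing.
  - by move=> n; apply: trigpolB; [exact: tq|exact: tq'].
  - move=> e e0; have e2 : 0 < e / 2 by rewrite divr_gt0.
    have [N hN] := represents_cauchy hq e2; have [N' hN'] := represents_cauchy hq' e2.
    exists (maxn N N') => m n; rewrite !geq_max => /andP[Nm N'm] /andP[Nn N'n].
    rewrite (_ : _ \- _ = (cplx (q m) \- cplx (q n)) \+ (\- (cplx (q' m) \- cplx (q' n))));
      last first.
      by apply/funext => x /=; ring.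
    have t1 : trigpol (cplx (q m) \- cplx (q n)) by apply: trigpolB; exact: tq.
    have t2 : trigpol (cplx (q' m) \- cplx (q' n)) by apply: trigpolB; exact: tq'.
    apply: (le_trans (rnorm1starD_le t1 (trigpolN t2))); rewrite rnorm1starN//.
    by apply: (le_trans (lerD (hN m n Nm Nn) (hN' m n N'm N'n))); rewrite -splitr.
  - move=> e e0; have e2 : 0 < e / 2 by rewrite divr_gt0.
    have [N hN] := represents_vanishing hf hq e2; have [N' hN'] := represents_vanishing hf hq' e2.
    exists (maxn N N') => n; rewrite geq_max => /andP[Nn N'n].
    have := hN _ Nn; have := hN' _ N'n => /= a b.
    have c1 : cL1 (cplx f \- cplx (q' n)).
      by rewrite -cplxB; apply: cL1_cplx; apply: Lfun1D => //; apply/Lfun1N/real_trigpol_L1.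
    have c2 : cL1 (\- (cplx f \- cplx (q n))).
      by rewrite -cplxB -cplxN; apply: cL1_cplx; apply/Lfun1N/Lfun1D => //;
        apply/Lfun1N/real_trigpol_L1.
    rewrite (_ : _ \- _ = (cplx f \- cplx (q' n)) \+ (\- (cplx f \- cplx (q n)))); last first.
      by apply/funext => x /=; ring.
    by apply: (le_trans (rnorm1D_le c1 c2)); rewrite rnorm1N; apply: (le_trans (lerD a b));
      rewrite -splitr.
have hl' : tends_to (fun n => rnorm1star (cplx (q' n))) l.
  move=> e e0; have e2 : 0 < e / 2 by rewrite divr_gt0.
  have [N hN] := hd _ e2; have [N' hN'] := hl _ e2.
  exists (maxn N N') => n; rewrite geq_max => /andP[Nn N'n].
  have := hN _ Nn; have := hN' _ N'n => /=.
  have := rnorm1star_leB (tq n) (tq' n); have := rnorm1star_leB (tq' n) (tq n).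
  have -> : rnorm1star (cplx (q' n) \- cplx (q n)) = rnorm1star (cplx (q n) \- cplx (q' n)).
    rewrite -[LHS]rnorm1starN; last by apply: trigpolB; [exact: tq'|exact: tq].
    by congr rnorm1star; apply/funext => x /=; ring.
  by move=> a b c d'; exact: (dist_le_halves a b d' c).
rewrite E// in hr; apply: (cvg_unique _ hr (tends_to_EFin hl')); exact: ereal_hausdorff.
Qed.

(** * Density of trigonometric polynomials in L2 *)

Lemma real_trigpol_Re p : trigpol p -> real_trigpol (Re \o p).
Proof.
move=> hp; rewrite /real_trigpol (_ : cplx _ = fun x => 2^-1 * (p x + (p x)^*)).
  by apply: trigpolZ; apply: trigpolD => //; exact: trigpolJ.
apply/funext => x; rewrite /cplx /=.
have -> : p x + (p x)^* = 2 * (Re (p x))%:C.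
  by apply: complexP; rewrite !(ReD, ImD, ReM, ImM, ReJ, ImJ) /=; ring.
by rewrite mulrA mulVf ?mul1r// pnatr_eq0.
Qed.

Lemma real_trigpol_cos n (b : R) : real_trigpol (fun x : pt => cos (phase n x + b)).
Proof.
have := real_trigpol_Re (trigpolZ (cos b +i* sin b) (trigpol_char n)).
rewrite (_ : _ \o _ = fun x : pt => cos (phase n x + b))//.
by apply/funext => x; rewrite /comp ReM /= cosD; ring.
Qed.

Lemma real_trigpol_L2 u : @real_trigpol R u -> u \in L2.
Proof. by move=> /trigpol_cL2/cL2P[]. Qed.

(** The L2 closure of the real trigonometric polynomials. *)
Definition L2_approximable (u : pt -> R) := u \in L2 /\
  forall e : R, 0 < e -> exists2 q : pt -> R, real_trigpol q & sqnorm2 (cplx u \- cplx q) <= e.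

Lemma L2_approximable_trigpol u : real_trigpol u -> L2_approximable u.
Proof.
move=> hu; split; first exact: real_trigpol_L2.
move=> e e0; exists u => //; rewrite (_ : _ \- _ = cst 0); last by apply/funext => x /=;
  rewrite subrr.
have := @sqnorm2Z 0 (cst 0) cL2_0.
rewrite normc0 expr0n mul0r (_ : (fun x => _) = cst 0) => [->|]; first exact: ltW.
by apply/funext => x; rewrite mul0r.
Qed.

Lemma L2_approximable_closed u : u \in L2 -> (forall e : R, 0 < e -> exists2 v, L2_approximable v &
  sqnorm2 (cplx u \- cplx v) <= e) -> L2_approximable u.
Proof.
move=> hu h; split => // e e0; have e4 : 0 < e / 4 by rewrite divr_gt0.
have [v [hv /(_ _ e4)[q hq vq]] uv] := h _ e4; exists q => //.
rewrite (_ : _ \- _ = (cplx u \- cplx v) \+ (cplx v \- cplx q)).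
  apply: (le_trans (sqnorm2D_le _ _)).
  - by apply: cL2B; exact: cL2_cplx.
  - by apply: cL2B; [exact: cL2_cplx|exact: trigpol_cL2].
  - apply: (le_trans (lerD (ler_wpM2l (ler0n _ 2) uv) (ler_wpM2l (ler0n _ 2) vq))).
    by rewrite le_eqVlt; apply/orP; left; apply/eqP; field.
by apply/funext => x /=; ring.
Qed.

Lemma cplxZ (c : R) (u : pt -> R) : cplx (fun x => c * u x) = fun x => c%:C * cplx u x.
Proof. by apply/funext => x; rewrite /cplx rmorphM. Qed.

Lemma L2_approximableZ (c : R) u : L2_approximable u -> L2_approximable (fun x => c * u x).
Proof.
move=> [hu h]; split.
  have := Lfun2Z c hu; rewrite (_ : _ \o* _ = fun x => c * u x)//.
  by apply/funext => x /=; rewrite mulrC.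
move=> e e0; have d0 : 0 < 1 + c ^+ 2 by rewrite ltr_pwDl// sqr_ge0.
have [q hq uq] := h _ (divr_gt0 e0 d0); exists (fun x => c * q x).
  by apply: real_trigpolM => //; exact: real_trigpol_cst.
rewrite !cplxZ (_ : _ \- _ = fun x => c%:C * (cplx u \- cplx q) x); last by apply/funext => x /=;
  ring.
rewrite sqnorm2Z; last by apply: cL2B; [exact: cL2_cplx|exact: trigpol_cL2].
move: uq; rewrite ler_pdivlMr// => uq; apply: le_trans uq.
by rewrite normc_real real_normK ?num_real// mulrC ler_wpM2l ?sqnorm2_ge0// lerDr.
Qed.

Lemma L2_approximableD u v : L2_approximable u -> L2_approximable v -> L2_approximable
  (fun x => u x + v x).
Proof.
move=> [hu h] [hv k]; split; first exact: Lfun2D.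
move=> e e0; have e4 : 0 < e / 4 by rewrite divr_gt0.
have [q hq uq] := h _ e4; have [r hr vr] := k _ e4.
exists (q \+ r); first exact: real_trigpolD.
rewrite -/(u \+ v) !cplxD (_ : _ \- _ = (cplx u \- cplx q) \+ (cplx v \- cplx r)); last first.
  by apply/funext => x /=; ring.
apply: (le_trans (sqnorm2D_le _ _)).
- by apply: cL2B; [exact: cL2_cplx|exact: trigpol_cL2].
- by apply: cL2B; [exact: cL2_cplx|exact: trigpol_cL2].
apply: (le_trans (lerD (ler_wpM2l (ler0n _ 2) uq) (ler_wpM2l (ler0n _ 2) vr))).
by rewrite le_eqVlt; apply/orP; left; apply/eqP; field.
Qed.

Lemma L2_approximable_sum (u : nat -> pt -> R) N : (forall k, L2_approximable (u k)) ->
  L2_approximable (fun x => \sum_(k < N) u k x).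
Proof.
move=> hu; elim: N => [|N ih].
  under eq_fun do rewrite big_ord0; apply: L2_approximable_trigpol; exact: real_trigpol_cst.
by under eq_fun do rewrite big_ord_recr /=; exact: L2_approximableD.
Qed.

(** The open fundamental square; it has full measure, and both
    [sin (pi x.1)] and [sin (pi x.2)] are positive on it. *)
Definition open_square : set pt := `]0, 1[%classic `*` `]0, 1[%classic.

Lemma ae_open_square : {ae (@haar2 R), forall x, open_square x}.
Proof.
have h0 : haar [set (0 : line)] = 0%E.
  rewrite /haar /mrestr; apply/eqP; rewrite eq_le measure_ge0 andbT.
  rewrite -(lebesgue_measure_set1 (0 : R)); apply: le_measure => //.
  - by rewrite inE; apply: measurableI; [exact: measurable_set1|exact: measurable_circle].
  - by rewrite inE; exact: measurable_set1.
have n1_ : (@haar2 R).-negligible ([set 0] `*` setT).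
  exists ([set 0] `*` setT); split => //; first by apply: measurableX => //; exact: measurable_set1.
  by rewrite /= /haar2 product_measure1E//= h0 mul0e.
have n2_ : (@haar2 R).-negligible (setT `*` [set 0]).
  exists (setT `*` [set 0]); split => //; first by apply: measurableX => //; exact: measurable_set1.
  by rewrite /= /haar2 product_measure1E//= h0 mule0.
have := negligibleU negligible_torusC (negligibleU n1_ n2_).
apply: negligibleS => -[s t] /= sq.
have [st|] := pselect (torus (s, t)); last by left.
right; move: st sq; rewrite /torus /open_square /circle /= !in_itv /= => -[/= /andP[s0
  s1] /andP[t0 t1]] sq.
have [/eqP s00|sn] := boolP (s == 0); first by left.
have [/eqP t00|tn] := boolP (t == 0); first by right.
by exfalso; apply: sq; rewrite /= !lt_neqAle ![0 == _]eq_sym sn tn s0 t0 -!lt_neqAle.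
Qed.

Lemma L2_approximable_lim (u : nat -> pt -> R) (v : pt -> R) (B : R) : measurable_fun setT v ->
  (forall x, torus x -> `|v x| <= B) ->
  (forall k, L2_approximable (u k)) -> (forall k x, torus x -> `|u k x| <= B) ->
  (forall x, open_square x -> u k x @[k --> \oo] --> v x) -> L2_approximable v.
Proof.
move=> mv vB hu uB uv; have hv : v \in L2 by exact: Lfun2_bounded vB.
apply: L2_approximable_closed => // e e0.
have mu k : measurable_fun setT (u k) by have [/Lfun_measurable] := hu k.
have := @dominated_convergence _ _ _ (@haar2 R) _ measurableT
  (fun k x => ((v x - u k x) ^+ 2)%:E) (cst 0%E) (cst ((2 * B) ^+ 2)%:E).
case.
- by move=> k; apply/measurable_EFinP; apply: measurable_funX; exact: measurable_funB.
- exact: measurable_cst.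
- apply: (filterS _ ae_open_square) => x sx _.
  apply: cvg_EFin; first exact: nearW.
  rewrite /= (_ : 0 = (v x - v x) ^+ 2); last by rewrite subrr expr0n.
  apply: (@cvg_comp _ _ _ (fun k => v x - u k x) (fun z => z ^+ 2)).
    by apply: cvgB; [exact: cvg_cst|exact: uv].
  exact: exprn_continuous.
- exact: finite_measure_integrable_cst.
- apply: (filterS _ ae_torus) => x tx k _ /=.
  rewrite lee_fin ger0_norm ?sqr_ge0// -[leLHS]real_normK ?num_real//.
  rewrite lerXn2r ?nnegrE ?mulr_ge0//; first exact: le_trans (vB _ tx).
  rewrite (le_trans (ler_normB _ _))// mulr_natl mulr2n lerD ?vB ?uB//.
move=> _ _; rewrite integral0 => /fine_cvgP[_ /cvgrPdist_le/(_ _ e0)[N _ hN]].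
exists (u N) => //; have := hN N (leqnn N); rewrite /= sub0r normrN.
rewrite (_ : sqnorm2 _ = fine (\int[haar2]_x ((v x - u N x) ^+ 2)%:E)).
  by apply: le_trans; rewrite ler_norm.
rewrite /sqnorm2; congr fine; apply: eq_integral => x _.
by rewrite -cplxB /cplx normc_real real_normK ?num_real.
Qed.

(** A bounded pointwise approximation of the sign by odd polynomials. *)
Lemma rsqrt_poly_sgn_cvg (w : R) : `|w| <= 1 -> w * rsqrt_poly k (w ^+ 2) @[k --> \oo] --> Num.sg w.
Proof.
move=> w1; have [w0|w0] := eqVneq w 0.
  by rewrite w0 sgr0; under eq_cvg do rewrite mul0r; exact: cvg_cst.
have t0 : 0 < `|w| by rewrite normr_gt0.
apply/cvgrPdist_le => e e0.
have [K hK] : exists K : nat, 2 / (e * `|w|) <= K%:R.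
  by exists (Num.truncn (2 / (e * `|w|))).+1; rewrite ltW// truncnS_gt.
exists K => // k /= Kk.
have [|/andP[y0 y1] yk] := @rsqrt_poly_bound k `|w|; first by rewrite normr_ge0.
have -> : Num.sg w - w * rsqrt_poly k (w ^+ 2) = Num.sg w * (1 - `|w| * rsqrt_poly k (`|w| ^+ 2)).
  by rewrite mulrBr mulr1 mulrA -numEsg real_normK ?num_real.
rewrite normrM normr_sg w0 mul1r ger0_norm ?subr_ge0//.
have kt : 2 <= e * (k%:R * `|w|).
  by rewrite mulrCA -ler_pdivrMr ?mulr_gt0//; apply: (le_trans hK); rewrite ler_nat.
have q0 : 0 < 2 + k%:R * `|w| by rewrite ltr_pwDl// mulr_ge0.
rewrite -(ler_pM2r q0); apply: (le_trans yk); apply: (le_trans kt).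
by rewrite ler_wpM2l ?(ltW e0)// lerDr.
Qed.

Lemma cvg_sg_indic (w : nat -> R) (z : R) : w k @[k --> \oo] --> Num.sg z ->
  (w k + w k ^+ 2) / 2 @[k --> \oo] --> ((0 < z)%R%:R : R).
Proof.
move=> h; have -> : (0 < z)%R%:R = (Num.sg z + Num.sg z ^+ 2) / 2 :> R.
  by case: sgrP; rewrite ?expr0n ?expr1n ?addr0 ?mul0r// ?sqrrN ?expr1n ?addNr ?mul0r// -mulr2n -mulr_natl mulr1 divff.
apply: cvgM; last exact: cvg_cst.
by apply: cvgD => //; exact: (cvgM h h).
Qed.

(** Measurable sets whose indicator is, on the open square, the pointwise limit of real
    trigonometric polynomials bounded by one.  They form a pi-system. *)
Definition trig_sets : set (set pt) := [set A | measurable A /\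
  exists u : nat -> pt -> R, [/\ forall k, real_trigpol (u k), forall k x, `|u k x| <= 1 &
    forall x, open_square x -> u k x @[k --> \oo] --> (\1_A x : R)]].

Lemma trig_sets_setI : setI_closed trig_sets.
Proof.
move=> A B [mA [u [hu u1 uA]]] [mB [v [hv v1 vB]]]; split; first exact: measurableI.
exists (fun k x => u k x * v k x); split.
- by move=> k; exact: real_trigpolM.
- by move=> k x; rewrite normrM mulr_ile1.
- by move=> x sx; rewrite indicI; apply: cvgM; [exact: uA|exact: vB].
Qed.

(** The positivity set of a real trigonometric polynomial [v] is such a set: with [s_k] the
    polynomial approximations of the sign of [v], take [(s_k + s_k ^ 2) / 2]. *)
Lemma trig_sets_gt0 (A : set pt) (v : pt -> R) : measurable A -> real_trigpol v ->
  (forall x, open_square x -> A x <-> 0 < v x) -> trig_sets A.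
Proof.
move=> mA hv Av; split => //; have [B B0 vB] := trigpol_bounded hv.
pose w x := B^-1 * v x.
have hw : real_trigpol w by apply: real_trigpolM => //; exact: real_trigpol_cst.
have w1 x : `|w x| <= 1.
  rewrite normrM ger0_norm ?invr_ge0 ?(ltW B0)// mulrC ler_pdivrMr// mul1r.
  by have := vB x; rewrite /cplx normc_real.
pose s k x := w x * rsqrt_poly k (w x ^+ 2).
have s1 k x : `|s k x| <= 1.
  have [|/andP[y0 y1] _] := @rsqrt_poly_bound k `|w x|; first by rewrite normr_ge0/=.
  have -> : `|s k x| = `| `|w x| * rsqrt_poly k (`|w x| ^+ 2) |.
    by rewrite real_normK ?num_real// [RHS]normrM normr_id /s normrM.
  by rewrite ger0_norm.
have hs k : real_trigpol (s k).
  by apply: real_trigpolM => //; apply: (@real_trigpol_rsqrt_poly k (fun x => w x ^+ 2));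
    exact: real_trigpolM.
exists (fun k x => 2^-1 * (s k x + s k x * s k x)); split.
- move=> k; apply: real_trigpolM; first exact: real_trigpol_cst.
  by apply: real_trigpolD => //; exact: real_trigpolM.
- move=> k x; rewrite normrM ger0_norm ?invr_ge0// mulrC ler_pdivrMr// mul1r.
  by rewrite (le_trans (ler_normD _ _))// mulr2n lerD// normrM mulr_ile1.
- move=> x sx; rewrite (_ : \1_A x = (0 < w x)%R%:R).
    have := cvg_sg_indic (rsqrt_poly_sgn_cvg (w1 x)).
    by apply: cvg_trans; apply: near_eq_cvg; apply: nearW => k; rewrite /s mulrC expr2.
  rewrite indicE; congr (nat_of_bool _)%:R; rewrite pmulr_rgt0 ?invr_gt0//.
  by apply/idP/idP; rewrite inE => /(Av _ sx).
Qed.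

Lemma cosB_cosD (a b : R) : cos (a - b) - cos (a + b) = 2 * (sin a * sin b).
Proof. by rewrite cosB cosD; ring. Qed.

Lemma sin_pi_gt0 (t : R) : 0 < t < 1 -> 0 < sin (pi * t).
Proof.
move=> /andP[t0 t1]; apply: sin_gt0_pi.
by rewrite mulr_gt0 ?pi_gt0//= gtr_pMr ?pi_gt0.
Qed.

(** On the open unit interval, [t < s] is the positivity of a trigonometric polynomial in
    [t], equal to [2 sin (pi t) sin (pi (s - t))]. *)
Lemma lt_cos_gt0 (s t : R) : 0 < s < 1 -> 0 < t < 1 ->
  (t < s) = (0 < cos (2 * pi * t + - (pi * s)) - cos (pi * s)).
Proof.
move=> s01 t01.
have -> : cos (2 * pi * t + - (pi * s)) - cos (pi * s) =
    2 * (sin (pi * t) * sin (pi * (s - t))).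
  rewrite -cosB_cosD; congr (cos _ - cos _); ring.
rewrite pmulr_rgt0// (pmulr_rgt0 _ (sin_pi_gt0 t01)).
have [ts|st|ts] := ltgtP t s.
- rewrite sin_pi_gt0 ?subr_gt0 ?ts//=.
  by move: s01 t01 => /andP[? ?] /andP[? ?]; lra.
- rewrite -opprB mulrN sinN oppr_gt0; apply/esym/negbTE; rewrite -leNgt ltW// sin_pi_gt0//.
  by rewrite subr_gt0 st /=; move: s01 t01 => /andP[? ?] /andP[? ?]; lra.
- by rewrite ts subrr mulr0 sin0 ltxx.
Qed.

Lemma trig_sets_ray n (pr : pt -> R) (s : R) : measurable_fun setT pr ->
  (forall x, open_square x -> 0 < pr x < 1) -> (forall x, phase n x = 2 * pi * pr x) ->
  trig_sets (pr @^-1` `]-oo, s[).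
Proof.
move=> mpr pr01 phE.
have mA : measurable (pr @^-1` `]-oo, s[) by rewrite -[X in measurable X]setTI; apply: mpr.
(* For s outside ]0, 1[ the ray is empty or full on the open square. *)
have [s0|s0] := leP s 0.
  apply: (trig_sets_gt0 mA (real_trigpol_cst 0)) => x /pr01 /andP[p0 _] /=.
  rewrite in_itv/= ltxx; split => // ps.
  by have := lt_trans (lt_le_trans ps s0) p0; rewrite ltxx.
have [s1|s1] := leP 1 s.
  apply: (trig_sets_gt0 mA (real_trigpol_cst 1)) => x /pr01 /andP[_ p1] /=.
  by rewrite in_itv/= ltr01; split => // _; exact: lt_le_trans s1.
apply: (trig_sets_gt0 mA (real_trigpolB (real_trigpol_cos n (- (pi * s)))
  (real_trigpol_cst (cos (pi * s))))).
by move=> x sx /=; rewrite in_itv/= phE lt_cos_gt0 ?s0 ?s1//; exact: pr01.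
Qed.

(** The half-strips [x.1 < s] and [x.2 < s] generate the product sigma-algebra. *)
Lemma measurable_trig_sets : @measurable _ pt = <<s trig_sets >>.
Proof.
rewrite eqEsubset; split; last first.
  apply: smallest_sub; first exact: sigma_algebra_measurable.
  by move=> A [].
have h (pr : pt -> line) : (forall s : R, trig_sets (pr @^-1` `]-oo, s[)) ->
    forall A : set line, measurable A -> <<s trig_sets >> (pr @^-1` A).
  move=> hpr A mA.
  have mf : measurable_fun (setT : set (g_sigma_algebraType trig_sets))
    (pr : g_sigma_algebraType trig_sets -> line).
    apply: (measurability (@RGenInftyO.G R)); first exact: RGenInftyO.measurableE.
    move=> _ [_ [s ->] <-]; rewrite setTI; apply: sub_sigma_algebra; exact: hpr.
  by have := mf measurableT A mA; rewrite setTI.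
have h1 := h fst (fun s => @trig_sets_ray (1, 0) fst s (@measurable_fst _ _ _ _) _ _).
have h2 := h snd (fun s => @trig_sets_ray (0, 1) snd s (@measurable_snd _ _ _ _) _ _).
rewrite measurable_prod_measurableType; apply: smallest_sub; first exact: smallest_sigma_algebra.
move=> _ [A mA] [B mB] <-; rewrite (_ : A `*` B = (fst @^-1` A) `&` (snd @^-1` B))//.
have : @measurable _ (g_sigma_algebraType trig_sets) ((fst @^-1` A) `&` (snd @^-1` B)).
  apply: measurableI.
    apply: h1 => //; first by move=> x [/=]; rewrite !in_itv.
    by move=> x; rewrite /phase /=; ring.
  apply: h2 => //; first by move=> x [_ /=]; rewrite !in_itv.
  by move=> x; rewrite /phase /=; ring.
by [].
Qed.

Lemma indic_bigcup_cvg (F : (set pt)^nat) (x : pt) : trivIset setT F ->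
  (\sum_(k < n) (\1_(F k) x : R)) @[n --> \oo] --> (\1_(\bigcup_k F k) x : R).
Proof.
move=> tF; rewrite indicE; case: (boolP (x \in _)) => [/set_mem[k _ Fk]|xF].
  apply: cvg_near_cst; exists k.+1 => // n /= kn.
  rewrite (bigD1 (Ordinal kn)) //= indicE mem_set// big1 ?addr0// => i ik.
  rewrite indicE; case: (boolP (x \in _)) => // /set_mem Fi.
  have := tF i k Logic.I Logic.I (ex_intro _ x (conj Fi Fk)).
  by move=> /eqP; rewrite -(inj_eq val_inj) in ik; rewrite (negbTE ik).
apply: cvg_near_cst; exists 0%N => // n _ /=.
rewrite big1// => i _; rewrite indicE; case: (boolP (x \in _)) => // /set_mem Fi.
by move/negP : xF; case; apply/mem_set; exists i.
Qed.

(** By Dynkin induction from the pi-system [trig_sets]. *)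
Lemma L2_approximable_indic (A : set pt) : measurable A -> L2_approximable (\1_A : pt -> R).
Proof.
move=> mA; have sA : <<s trig_sets >> A by rewrite -measurable_trig_sets.
have b1 (D : set pt) x : `|\1_D x : R| <= 1 by rewrite indicE; case: (_ \in _);
  rewrite ?normr1 ?normr0.
move: A sA {mA}; apply: (dynkin_induction measurable_trig_sets trig_sets_setI).
- have := L2_approximable_trigpol (real_trigpol_cst 1); rewrite (_ : (fun=> 1) = \1_setT)//.
  by apply/funext => x; rewrite indicT.
- move=> A [mA [u [hu u1 uA]]]; apply: (@L2_approximable_lim u _ 1) => //.
  by move=> k; exact: L2_approximable_trigpol.
- move=> A mA hA.
  have := L2_approximableD (L2_approximable_trigpol (real_trigpol_cst 1))
    (L2_approximableZ (-1) hA).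
  rewrite (_ : (fun x => _) = \1_(~` A))//; apply/funext => x.
  by rewrite !indicE in_setC; case: (x \in A); rewrite /= mulN1r ?subrr ?oppr0 ?addr0.
- move=> F mF tF hF.
  apply: (@L2_approximable_lim (fun n x => \sum_(k < n) (\1_(F k) x : R)) _ 1) => //.
  + exact/measurable_indic/bigcup_measurable.
  + by move=> k; apply: (L2_approximable_sum (u := fun k => \1_(F k))).
  + move=> n x _.
    have [[k Fk]|h] := pselect (exists k : 'I_n, F k x); last first.
      rewrite big1 ?normr0// => i _; rewrite indicE; case: (boolP (x \in _)) => // /set_mem Fi.
      by exfalso; apply: h; exists i.
    rewrite (bigD1 k) //= big1 ?addr0// => i ik.
    rewrite indicE; case: (boolP (x \in _)) => // /set_mem Fi.
    have := tF i k Logic.I Logic.I (ex_intro _ x (conj Fi Fk)).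
    by move=> /eqP; rewrite -(inj_eq val_inj) in ik; rewrite (negbTE ik).
  + by move=> x _; exact: indic_bigcup_cvg.
Qed.

(** The number of integers [j < N] below [y] is [y] up to one unit. *)
Lemma sum_lt_nat_bound (N : nat) (y : R) : 0 <= y <= N%:R ->
  y <= \sum_(j < N) (j%:R < y)%R%:R <= y + 1.
Proof.
elim: N => [|N ih] /andP[y0 yN].
  by rewrite big_ord0 yN ltW// ltr_pwDr.
rewrite big_ord_recr /=; have [yN'|Ny] := leP y N%:R.
  by rewrite addr0; apply: ih; rewrite y0.
rewrite (eq_bigr (fun=> 1)) => [|i _]; last by rewrite (lt_trans _ Ny)// ltr_nat.
rewrite sumr_const card_ord natr1 yN -natr1.
by rewrite lerD2r ltW.
Qed.

(** If [u] is bounded by [B], then [u + B] is uniformly approximated by the counting of its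
    layers [n^-1 * #{j | j < n (u + B)}], a combination of indicators. *)
Lemma L2_approximable_bounded (u : pt -> R) (B : R) : measurable_fun setT u ->
  (forall x, torus x -> `|u x| <= B) -> L2_approximable u.
Proof.
move=> mu uB; apply: L2_approximable_closed; first exact: Lfun2_bounded uB.
move=> e e0.
pose n := (Num.truncn (1 + e^-1)).+1.
have n_gt0 : 0 < n%:R :> R by rewrite ltr0n.
have ne : n%:R^-1 ^+ 2 <= e.
  have h : 1 + e^-1 <= n%:R by rewrite ltW// truncnS_gt.
  have n_ge1 : 1 <= n%:R :> R by rewrite ler1n.
  rewrite exprVn invf_ple ?posrE ?exprn_gt0//; apply: (@le_trans _ _ n%:R).
    by apply: le_trans h; rewrite lerDr.
  by rewrite expr2 ler_pMl.
pose N := (Num.truncn (n%:R * (2 * B))).+1.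
have hN : n%:R * (2 * B) <= N%:R by rewrite ltW// truncnS_gt.
pose y x := n%:R * (u x + B).
have my : measurable_fun setT y by apply: measurable_funM => //; exact: measurable_funD.
pose A j := y @^-1` `]j%:R, +oo[.
have mA j : measurable (A j) by rewrite -[A j]setTI; apply: my.
pose v x := n%:R^-1 * (\sum_(j < N) \1_(A j) x) + (- B).
exists v.
  apply: (L2_approximableD _ (L2_approximable_trigpol (real_trigpol_cst _))).
  by apply: L2_approximableZ; apply: (L2_approximable_sum (u := fun j => \1_(A j))) => j;
    exact: L2_approximable_indic.
have hv : L2_approximable v.
  apply: (L2_approximableD _ (L2_approximable_trigpol (real_trigpol_cst _))).
  by apply: L2_approximableZ; apply: (L2_approximable_sum (u := fun j => \1_(A j))) => j;
    exact: L2_approximable_indic.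
apply: le_trans ne.
have -> : n%:R^-1 ^+ 2 = sqnorm2 (cplx (cst n%:R^-1)).
  rewrite /sqnorm2 -[LHS]Rint_cst; apply: eq_Rintegral => x _.
  by rewrite /cplx normc_real real_normK ?num_real.
apply: le_sqnorm2.
- apply: cL2B; apply: cL2_cplx; first exact: Lfun2_bounded uB.
  by case: hv.
- by apply: cL2_cplx; exact: Lfun_cst.
- move=> x tx; rewrite -cplxB /cplx !normc_real /= [leRHS]ger0_norm ?invr_ge0 ?(ltW n_gt0)//.
  have := uB _ tx; rewrite ler_norml => /andP[u1 u2].
  (* The layers of u + B, of height 1 / n, are indexed by j < N, where N >= 2 n B. *)
  have y0N : 0 <= y x <= N%:R.
    rewrite mulr_ge0 ?(ltW n_gt0)//=; last by rewrite -lerBlDr sub0r.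
    apply: le_trans hN; rewrite ler_pM2l// mulr_natl mulr2n lerD2r//.
  have := sum_lt_nat_bound y0N.
  have -> : \sum_(j < N) ((j%:R < y x)%R%:R : R) = \sum_(j < N) \1_(A j) x.
    apply: eq_bigr => j _; rewrite indicE; congr (nat_of_bool _)%:R.
    by apply/idP/idP; rewrite inE /A /= in_itv/= andbT.
  rewrite /v; move: (\sum_(j < N) _) => S /andP[S1 S2].
  have -> : u x - (n%:R^-1 * S + - B) = n%:R^-1 * (y x - S).
    by rewrite /y; field; rewrite gt_eqF.
  rewrite normrM ger0_norm ?invr_ge0 ?(ltW n_gt0)// ger_pMr ?invr_gt0//.
  by rewrite ler_norml; apply/andP; split; [rewrite lerBrDr addrC lerBlDr|rewrite lerBlDr
    (le_trans S1)// lerDr].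
Qed.

(** * Bounded functions belong to the Hardy space *)

Lemma sqnorm2_diff_le f g h : cL2 f -> cL2 g -> cL2 h ->
  sqnorm2 (f \- g) <= 2 * sqnorm2 (h \- f) + 2 * sqnorm2 (h \- g).
Proof.
move=> hf hg hh; rewrite [sqnorm2 (h \- f)]sqnorm2BC.
rewrite (_ : f \- g = (f \- h) \+ (h \- g)); last by apply/funext => x /=; ring.
by apply: sqnorm2D_le; exact: cL2B.
Qed.

Lemma sqnorm2_le_approx f g : cL2 f -> cL2 g -> sqnorm2 g <= 2 * sqnorm2 f + 2 * sqnorm2 (f \- g).
Proof.
move=> hf hg; rewrite [sqnorm2 (f \- g)]sqnorm2BC.
rewrite [in leLHS](_ : g = f \+ (g \- f)); last by apply/funext => x /=; ring.
by apply: sqnorm2D_le => //; exact: cL2B.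
Qed.

(** Bounded measurable functions belong to the Hardy space; the representing sequence
    moreover converges in L2. *)
Lemma bounded_represents (u : pt -> R) (B : R) : measurable_fun setT u ->
  (forall x, torus x -> `|u x| <= B) ->
  u \in L1 /\ exists q : (pt -> R)^nat, represents q u /\ vanishing
    (fun n => sqnorm2 (cplx u \- cplx (q n))).
Proof.
move=> mu uB; have [hu hap] := L2_approximable_bounded mu uB.
have hu1 := Lfun2_Lfun1 hu.
split=> //.
have /choice[q hq] : forall n : nat, exists q : pt -> R, real_trigpol q /\
    sqnorm2 (cplx u \- cplx q) <= n.+1%:R^-1.
  by move=> n; have [|q hq uq] := hap n.+1%:R^-1; [rewrite invr_gt0|exists q].
have tq n : real_trigpol (q n) by have [] := hq n.
have van : vanishing (fun n => sqnorm2 (cplx u \- cplx (q n))).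
  move=> e e0; exists (Num.truncn e^-1).+1 => n Nn; have [_ h] := hq n.
  apply: (le_trans h); rewrite invf_ple ?posrE//.
  apply: (@le_trans _ _ (Num.truncn e^-1).+1%:R); first by rewrite ltW// truncnS_gt.
  by rewrite ler_nat ltnW.
have cu := cL2_cplx hu.
have ct n := trigpol_cL2 (tq n).
exists q; split => //; split => //.
- move=> e e0; have e4 : 0 < (e / 2) ^+ 2 / 4 by rewrite divr_gt0// exprn_gt0// divr_gt0.
  have [N hN] := van _ e4; exists N => m n Nm Nn.
  rewrite norm1star_rnorm1star ?lee_fin; last exact: real_trigpolB.
  rewrite [leRHS](_ : e = 2 * (e / 2)); last by field.
  rewrite cplxB; apply: rnorm1star_small; [by apply: trigpolB; exact: tq|by rewrite divr_gt0|].
  apply: (le_trans (sqnorm2_diff_le (ct m) (ct n) cu)).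
  apply: (le_trans (lerD (ler_wpM2l (ler0n _ 2) (hN m Nm)) (ler_wpM2l (ler0n _ 2) (hN n Nn)))).
  by rewrite le_eqVlt; apply/orP; left; apply/eqP; field.
- have h1 : vanishing (fun n => rnorm1 (cplx u \- cplx (q n))).
    move=> e e0; have [N hN] := van _ (exprn_gt0 2 e0); exists N => n Nn.
    by apply: rnorm1_small => //; [exact: cL2B|exact: hN].
  have := (vanishing_cvg (fun n => rnorm1_ge0 (cplx u \- cplx (q n)))).1 h1.
  apply: cvg_trans; apply: near_eq_cvg; apply: nearW => n.
  by rewrite -cplxB norm1E//; apply: Lfun1D => //; apply/Lfun1N/real_trigpol_L1.
Qed.

(** * The weighted estimate behind the boundedness of atoms *)

Lemma cL2M_bounded f g (B : R) : cL2 f -> measurable_fun setT (Re \o g) ->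
  measurable_fun setT (Im \o g) -> (forall x, torus x -> normc (g x) <= B) ->
  cL2 (fun x => g x * f x) /\ sqnorm2 (fun x => g x * f x) <= B ^+ 2 * sqnorm2 f.
Proof.
move=> hf mr mi gB; have [fr fi _] := hf.
have B0 : 0 <= B.
  have t0 : torus ((0, 0) : pt) by split; rewrite /circle /= in_itv/= lexx ltr01.
  exact: le_trans (normc_ge0 _) (gB _ t0).
have nf := cL2_normc hf.
have le x : torus x -> normc (g x * f x) <= `|B * normc (f x)|.
  by move=> tx; rewrite normcM ger0_norm ?mulr_ge0 ?normc_ge0// ler_wpM2r ?normc_ge0// gB.
have hB : B \o* (@normc R \o f) \in L2 by exact: Lfun2Z.
have c : cL2 (fun x => g x * f x).
  apply/cL2P; split.
    apply: (Lfun2_le _ hB).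
      rewrite (_ : _ \o _ = (fun x => (Re \o g) x * (Re \o f) x - (Im \o g) x * (Im \o f) x)).
        by apply: measurable_funB; exact: measurable_funM.
      by apply/funext => x; rewrite /comp ReM.
    by move=> x tx /=; rewrite [_ * B]mulrC; apply: le_trans (le _ tx); exact: le_Re_normc.
  apply: (Lfun2_le _ hB).
    rewrite (_ : _ \o _ = (fun x => (Re \o g) x * (Im \o f) x + (Im \o g) x * (Re \o f) x)).
      by apply: measurable_funD; exact: measurable_funM.
    by apply/funext => x; rewrite /comp ImM.
  by move=> x tx /=; rewrite [_ * B]mulrC; apply: le_trans (le _ tx); exact: le_Im_normc.
split => //; rewrite -[X in X ^+ 2](ger0_norm B0) -normc_real -sqnorm2Z//.
apply: le_sqnorm2 => //; first exact: cL2Z.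
by move=> x tx; rewrite !normcM normc_real ger0_norm// ler_wpM2r ?normc_ge0// gB.
Qed.

(** The inequality of arithmetic and geometric means for a weight [A] with inverse at most
    [V]. *)
Lemma le_amgm (G A V : R) : 0 < A -> 1 <= A * V -> G <= (A * G ^+ 2 + V) / 2.
Proof.
move=> A0 AV; rewrite -(ler_pM2l A0) -subr_ge0.
rewrite (_ : _ - _ = ((A * G - 1) ^+ 2 + (A * V - 1)) / 2); last by field.
by rewrite divr_ge0// addr_ge0 ?sqr_ge0// subr_ge0.
Qed.

Lemma normcX (z : R[i]) k : normc (z ^+ k) = normc z ^+ k.
Proof. by elim: k => [|k ih]; rewrite ?expr0 ?normc1// !exprS normcM ih. Qed.

Lemma normcB_ge (z w : R[i]) : normc z - normc w <= normc (z - w).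
Proof. by rewrite lerBlDr -{1}[z](subrK w) le_normcD. Qed.

(** The two coordinate frequencies. *)
Definition is_axis (e : int * int) := e = (1, 0) \/ e = (0, 1).

Lemma sqnorm2_geometric (e : int * int) (z : R[i]) N : is_axis e -> normc z < 1 ->
  sqnorm2 (fun x => \sum_(k < N) (z * character e x) ^+ k) <= (1 - normc z ^+ 2)^-1.
Proof.
move=> he z1; pose idx (n : int * int) := absz (n.1 + n.2).
have mulrnE k : e *+ k = (e.1 *+ k, e.2 *+ k).
  by elim: k => [//|k ih]; rewrite !mulrS ih.
have idxE k : idx (e *+ k) = k.
  by rewrite mulrnE; case: he => ->; rewrite /idx /= mul0rn ?addr0 ?add0r natz.
have charX k (x : pt) : character (e *+ k) x = character e x ^+ k.
  by elim: k => [|k ih]; rewrite ?char0// mulrS charD ih exprS.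
pose s := [seq e *+ k | k <- index_iota 0 N].
have us : uniq s by rewrite map_inj_uniq ?iota_uniq//; exact: (can_inj idxE).
rewrite (_ : (fun x => _) = trigsum s (fun n => z ^+ idx n)); last first.
  apply/funext => x; rewrite /trigsum big_map big_mkord; apply: eq_bigr => k _.
  by rewrite idxE charX exprMn.
rewrite sqnorm2_trigsum// big_map big_mkord.
have z0 := normc_ge0 z.
have rho : 0 < 1 - normc z ^+ 2 by rewrite subr_gt0 expr_lt1.
rewrite -[leRHS]mul1r ler_pdivlMr// mulrC.
have -> : \sum_(k < N) normc (z ^+ idx (e *+ k)) ^+ 2 = \sum_(k < N) (normc z ^+ 2) ^+ k.
  by apply: eq_bigr => k _; rewrite idxE normcX -!exprM mulnC.
have := subrX1 (normc z ^+ 2) N.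
move: (\sum_(k < N) _) => S eS.
have -> : (1 - normc z ^+ 2) * S = 1 - (normc z ^+ 2) ^+ N.
  by rewrite -[LHS]opprK -mulNr opprB -eS opprB.
by rewrite gerBl exprn_ge0// sqr_ge0.
Qed.

Lemma exists_expr_le_half (r : R) : 0 <= r < 1 -> exists N, r ^+ N <= 1 / 2.
Proof.
move=> /andP[r0 r1]; have : `|r| < 1 by rewrite ger0_norm.
move=> /cvg_expr/cvgrPdist_le/(_ (1 / 2)) -[|N _ hN]; first by rewrite divr_gt0.
exists N; have := hN N (leqnn N).
by rewrite /= sub0r normrN ger0_norm// exprn_ge0.
Qed.

Lemma cL2M_char_sub e (w : R[i]) f : cL2 f -> normc w = 1 ->
  cL2 (fun x => (character e x - w) * f x) /\
  sqnorm2 (fun x => (character e x - w) * f x) <= 4 * sqnorm2 f.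
Proof.
move=> hf w1; rewrite (_ : 4 = 2 ^+ 2); last by rewrite -natrX.
have c := cL2B (cL2_char e) (trigpol_cL2 (trigpol_cst w)); have [mr mi _] := c.
apply: (cL2M_bounded hf mr mi) => x _ /=.
by rewrite (le_trans (le_normcD _ _))// normc_char normcN w1 -natr1.
Qed.

(** A function whose mass is concentrated, in the L2 sense, at scale [d] around the points
    where the character [e] takes the value [w] is bounded in L1.  The weight comes from a
    damped geometric sum [h], whose L2 norm is computed by Parseval. *)
Lemma weight_bound e (w : R[i]) (d : R) f : is_axis e -> normc w = 1 -> 0 < d <= 1 -> cL2 f ->
  rnorm1 f <= 4 * (d * sqnorm2 f + sqnorm2 (fun x => (character e x - w) * f x) / d) + 1 / 2.
Proof.
move=> he w1 /andP[d0 d1] hf; pose r := 1 - d.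
have r01 : 0 <= r < 1 by rewrite subr_ge0 d1 gtrBl.
have [r0 r1] := andP r01.
have [N hN] := exists_expr_le_half r01.
pose z := r%:C * w^*.
have zr : normc z = r by rewrite normcM normc_real normc_conj w1 mulr1 ger0_norm.
pose h (x : pt) := \sum_(k < N) (z * character e x) ^+ k.
have ch : cL2 h.
  apply: trigpol_cL2; apply: trigpol_sum => k.
  elim: (nat_of_ord k) => [|j ih]; first by under eq_fun do rewrite expr0; exact: trigpol_cst.
  under eq_fun do rewrite exprS; apply: trigpolM => //.
  by apply: trigpolZ; exact: trigpol_char.
have nh : d * sqnorm2 h <= 1.
  have := @sqnorm2_geometric e z N he; rewrite zr => /(_ r1) h1.
  apply: (le_trans (ler_wpM2l (ltW d0) h1)).
  have e1 : 1 - r ^+ 2 = d * (1 + r) by rewrite /r; ring.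
  rewrite e1 invfM mulrA divff ?gt_eqF// mul1r invf_le1 ?ltr_pwDl// lerDl//.
have [cg _] := cL2M_char_sub e hf w1.
have i1 := Lfun1Z (4 * d) (cL2_sqr hf).
have i2 := Lfun1Z (4 / d) (cL2_sqr cg).
have i3 := Lfun1Z (d / 2) (cL2_sqr ch).
apply: (@le_trans _ _ (4 * d * sqnorm2 f + 4 / d * sqnorm2 (fun x => (character e x - w) * f x) +
  d / 2 * sqnorm2 h)); last first.
  have -> : 4 * (d * sqnorm2 f + sqnorm2 (fun x => (character e x - w) * f x) / d) =
     4 * d * sqnorm2 f + 4 / d * sqnorm2 (fun x => (character e x - w) * f x).
    by rewrite mulrDr mulrA; congr (_ + _); rewrite -!mulrA; congr (_ * _); rewrite mulrC.
  by rewrite lerD2l mulrAC ler_wpM2r.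
rewrite /rnorm1 {1}/sqnorm2 -RintZ ?cL2_sqr// {1}/sqnorm2 -RintZ ?cL2_sqr// -RintD//.
rewrite {1}/sqnorm2 -RintZ ?cL2_sqr// -RintD//; last exact: Lfun1D.
apply: Rint_le; [exact/cL1_normc/cL2_cL1|exact: (Lfun1D (Lfun1D i1 i2) i3)|move=> x _].
set D := normc (character e x - w); have D0 : 0 <= D by exact: normc_ge0.
set V := normc (h x); have V0 : 0 <= V by exact: normc_ge0.
(* The geometric sum telescopes: (z chi - 1) h = (z chi) ^ N - 1, of modulus at
   least 1 - r ^ N. *)
have key : 1 / 2 <= (d + D) * V.
  have e1 : (z * character e x) ^+ N - 1 = (z * character e x - 1) * h x by exact: subrX1.
  have l1 : 1 / 2 <= normc (1 - (z * character e x) ^+ N).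
    apply: le_trans (normcB_ge _ _); rewrite normc1 normcX normcM zr normc_char mulr1.
    by rewrite lerBrDl -lerBrDr; apply: (le_trans hN); rewrite le_eqVlt; apply/orP; left;
      apply/eqP; field.
  have l2 : normc (z * character e x - 1) <= d + D.
    have -> : z * character e x - 1 = (- d)%:C + r%:C * w^* * (character e x - w).
      rewrite mulrBr -/z addrCA; congr (_ + _).
      rewrite /z -mulrA [w^* * w]mulrC mulcJ w1 expr1n mulr1 /r.
      by apply: complexP; rewrite !(ReD, ImD) /=; ring.
    rewrite (le_trans (le_normcD _ _))// normc_real normrN ger0_norm ?(ltW d0)// lerD2l.
    by rewrite normcM -/z zr -/D ler_piMl// ltW.
  apply: (le_trans l1); rewrite -normcN opprB e1 normcM.
  by rewrite ler_wpM2r.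
have A0 : 0 < 8 * (d ^+ 2 + D ^+ 2) / d by rewrite divr_gt0// mulr_gt0// ltr_wpDr ?sqr_ge0//
  exprn_gt0.
(* Parallelogram law: 2 (d ^ 2 + D ^ 2) = (d + D) ^ 2 + (d - D) ^ 2. *)
have AV : 1 <= 8 * (d ^+ 2 + D ^+ 2) / d * (d * V ^+ 2).
  have -> : 8 * (d ^+ 2 + D ^+ 2) / d * (d * V ^+ 2) =
    4 * ((d + D) * V) ^+ 2 + 4 * ((d - D) * V) ^+ 2.
    by field; rewrite gt_eqF.
  have : (1 / 2) ^+ 2 <= ((d + D) * V) ^+ 2 by rewrite lerXn2r// ?nnegrE ?mulr_ge0 ?addr_ge0 ?(ltW
    d0).
  rewrite (_ : (1 / 2) ^+ 2 = 1 / 4 :> R); last by field.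
  have := sqr_ge0 ((d - D) * V); move: (_ ^+ 2) (_ ^+ 2) => a b a0 b0; lra.
apply: (le_trans (le_amgm (normc (f x)) A0 AV)).
rewrite /= normcM -/D -/V exprMn le_eqVlt; apply/orP; left; apply/eqP.
by field; rewrite gt_eqF.
Qed.

(** The coordinate frequencies are positive, hence translation by them preserves the cone. *)
Lemma Xplus_axis n e : is_axis e -> Xplus n -> Xplus (n + e).
Proof.
case: n => m1 n2; rewrite /is_axis /Xplus => -[]-> /=; rewrite ?addr0 => -[h|[h1 h2]].
- by left; rewrite addr_gt0.
- by left; rewrite h1 add0r.
- by left.
- by right; rewrite h1; split => //; rewrite addr_ge0.
Qed.

Lemma fourier_charM e (w : R[i]) f n : cL2 f -> normc w = 1 ->
  fourier (fun x => (character e x - w) * f x) n = fourier f (n - e) - w * fourier f n.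
Proof.
move=> hf w1.
have c1 : cL2 (fun x => character e x * f x).
  have [mr mi _] := cL2_char e.
  by case: (@cL2M_bounded f (character e) 1 hf mr mi) => // x _; rewrite normc_char.
have c2 := cL2Z w hf.
rewrite (_ : (fun x => _) = (fun x => character e x * f x) \- (fun x => w * f x)); last first.
  by apply/funext => x /=; rewrite mulrBl.
rewrite fourierB// [fourier (fun x => w * f x) n]innerZl//; last exact: cL2_char.
congr (_ - _); rewrite /fourier /inner; congr cintegral; apply/funext => x.
by rewrite charD charN rmorphM /= conjCK; ring.
Qed.

(** The commutator of [P_+] with multiplication by [character e - w] only involves the
    frequencies that translation by [e] brings into the positive cone.  If the function
    [a] approximated by [p] has only [- e] among them, Bessel bounds the commutator: as
    [a] has mean zero, its coefficient at [- e] is the mean of [(character e - w) * a]. *)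
Lemma sqnorm2_commutator e (w : R[i]) (a p : pt -> R[i]) : is_axis e -> normc w = 1 ->
  cL2 a -> trigpol p -> fourier a 0 = 0 ->
  (forall n, ~ Xplus n -> Xplus (n + e) -> n <> - e -> fourier a n = 0) ->
  sqnorm2 (proj_plus (fun x => (character e x - w) * p x) \-
    (fun x => (character e x - w) * proj_plus p x)) <=
  2 * sqnorm2 (a \- p) + 2 * sqnorm2 (fun x => (character e x - w) * a x).
Proof.
move=> he w1 ca hp a0 acr; have cp := trigpol_cL2 hp.
have tchi : trigpol (fun x => character e x - w).
  by apply: trigpolB; [exact: trigpol_char|exact: trigpol_cst].
have tQ : trigpol (fun x => (character e x - w) * p x) by exact: trigpolM.
have tG : trigpol (fun x => (character e x - w) * proj_plus p x).
  by apply: trigpolM => //; exact: trigpol_proj_plus.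
set E := _ \- _; have tE : trigpol E by apply: trigpolB => //; exact: trigpol_proj_plus.
have fE m : fourier E m = if Xplusb m && ~~ Xplusb (m - e) then fourier p (m - e) else 0.
  rewrite /E fourierB; [|exact/trigpol_cL2/trigpol_proj_plus|exact: trigpol_cL2].
  rewrite fourier_proj_plus// !fourier_charM//; last exact/trigpol_cL2/trigpol_proj_plus.
  rewrite !fourier_proj_plus//; case: (boolP (Xplusb (m - e))) => [|_] /=.
    move=> /asboolP/(Xplus_axis he); rewrite subrK => Xm.
    by rewrite andbF /Xplusb asboolT// subrr.
  by rewrite andbT; case: (Xplusb m); ring.
set c := normc (fourier a (- e)) ^+ 2.
have c0 : 0 <= c by rewrite sqr_ge0.
have ce : c <= sqnorm2 (fun x => (character e x - w) * a x).
  have [cw _] := cL2M_char_sub e ca w1.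
  have := bessel (s := [:: 0]) cw isT; rewrite big_seq1 fourier_charM// a0 mulr0 subr0 sub0r.
  by [].
have [us Ee] := spectrumP tE; rewrite [in leLHS]Ee sqnorm2_trigsum//; set s := spectrum E in us *.
apply: (@le_trans _ _ (\sum_(m <- s) (2 * normc (fourier (a \- p) (m - e)) ^+ 2 +
  if m == 0 then 2 * c else 0))).
  apply: ler_sum => m _; rewrite fE; case: ifPn => [/andP[/asboolP Xm /asboolPn Xme]|_]; last first.
    rewrite normc0 expr0n; apply: addr_ge0; first by apply: mulr_ge0 => //; exact: sqr_ge0.
    by case: ifP => // _; apply: mulr_ge0.
  rewrite fourierB//; case: eqVneq => [->|m0].
    (* At the frequency - e: |z| ^ 2 <= 2 |y - z| ^ 2 + 2 |y| ^ 2. *)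
    rewrite sub0r /c; set y := fourier a _; set z := fourier p _.
    rewrite !normc2E !(ReD, ImD); case: y z => y1 y2 [z1 z2] /=; rewrite -subr_ge0.
    rewrite (_ : _ - _ = (2 * y1 - z1) ^+ 2 + (2 * y2 - z2) ^+ 2); last by ring.
    by rewrite addr_ge0 ?sqr_ge0.
  rewrite (acr (m - e)) ?subrK//; last first.
    by move=> h; case/eqP : m0; rewrite -[m](subrK e) h addNr.
  by rewrite sub0r normcN addr0 ler_peMl ?sqr_ge0// ler1n.
rewrite big_split /=; apply: lerD.
  rewrite -mulr_sumr ler_wpM2l//.
  have um : uniq [seq m - e | m <- s] by rewrite map_inj_uniq//; exact: addIr.
  have := bessel (cL2B ca cp) um; by rewrite big_map.
apply: (@le_trans _ _ (2 * c)); last by rewrite ler_wpM2l.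
have [s0|s0] := boolP (0 \in s).
  by rewrite (bigD1_seq 0) //= big1 ?addr0// => i /negbTE ->.
rewrite big_seq big1 => [|i si]; first exact: mulr_ge0 (ler0n _ 2) c0.
case: eqVneq => // i0; by rewrite -i0 si in s0.
Qed.

(** The uniform bound: [d] is the scale of the atom [a], and [p] any trigonometric
    polynomial close enough to [a] in L2. *)
Lemma rnorm1star_atomic_bound e (w : R[i]) (d K : R) (a p : pt -> R[i]) :
  is_axis e -> normc w = 1 ->
  0 < d <= 1 -> 0 <= K -> cL2 a -> trigpol p -> sqnorm2 a <= 1 / d ->
  sqnorm2 (fun x => (character e x - w) * a x) <= K * d -> fourier a 0 = 0 ->
  (forall n, ~ Xplus n -> Xplus (n + e) -> n <> - e -> fourier a n = 0) ->
  sqnorm2 (a \- p) <= d -> rnorm1star p <= 72 * K + 242.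
Proof.
move=> he w1 d01 K0 ca hp na naw a0 acr nap; have cp := trigpol_cL2 hp.
have [d0 d1] := andP d01.
have tchi : trigpol (fun x => character e x - w).
  by apply: trigpolB; [exact: trigpol_char|exact: trigpol_cst].
have tQ : trigpol (fun x => (character e x - w) * p x) by exact: trigpolM.
have tP := trigpol_proj_plus p; have cP := trigpol_cL2 tP.
have tG : trigpol (fun x => (character e x - w) * proj_plus p x) by exact: trigpolM.
have np : d * sqnorm2 p <= 4.
  have h : sqnorm2 p <= 2 * (1 / d) + 2 * d.
    by apply: (le_trans (sqnorm2_le_approx ca cp)); rewrite lerD// ler_wpM2l.
  apply: (le_trans (ler_wpM2l (ltW d0) h)).
  rewrite mulrDr [d * _]mulrCA mul1r divff ?gt_eqF// mulr1 [d * _]mulrCA.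
  have : d * d <= 1 by rewrite mulr_ile1// ltW.
  by move: (d * d) => z hz; lra.
have nQ : sqnorm2 (fun x => (character e x - w) * p x) <= (2 * K + 8) * d.
  have [cw _] := cL2M_char_sub e ca w1; have [cd hd] := cL2M_char_sub e (cL2B ca cp) w1.
  have := sqnorm2_le_approx cw (trigpol_cL2 tQ).
  rewrite (_ : _ \- _ = (fun x => (character e x - w) * (a \- p) x)); last first.
    by apply/funext => x /=; rewrite mulrBr.
  move=> h; apply: (le_trans h); have -> : (2 * K + 8) * d = 2 * (K * d) + 2 * (4 * d) by ring.
  by rewrite lerD// ler_wpM2l// (le_trans hd)// ler_wpM2l.
(* (z - w) P_+ p is P_+ ((z - w) p) minus the commutator. *)
have nG : sqnorm2 (fun x => (character e x - w) * proj_plus p x) <= (8 * K + 20) * d.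
  have hE := sqnorm2_commutator he w1 ca hp a0 acr.
  have cPQ := trigpol_cL2 (trigpol_proj_plus (fun x => (character e x - w) * p x)).
  have := sqnorm2_le_approx cPQ (trigpol_cL2 tG).
  have := sqnorm2_proj_plus tQ => h1 h2; apply: (le_trans h2).
  have -> : (8 * K + 20) * d = 2 * ((2 * K + 8) * d) + 2 * (2 * d + 2 * (K * d)) by ring.
  apply: lerD; first by rewrite ler_wpM2l// (le_trans h1).
  by rewrite ler_wpM2l//; apply: (le_trans hE); rewrite lerD// ler_wpM2l.
have b1 : rnorm1 p <= 8 * K + 97 / 2.
  apply: (le_trans (weight_bound he w1 d01 cp)).
  have : sqnorm2 (fun x => (character e x - w) * p x) / d <= 2 * K + 8 by rewrite ler_pdivrMr.
  by move: np; move: (d * _) (_ / d) => y z hy hz; lra.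
have b2 : rnorm1 (proj_plus p) <= 32 * K + 193 / 2.
  apply: (le_trans (weight_bound he w1 d01 cP)).
  have : sqnorm2 (fun x => (character e x - w) * proj_plus p x) / d <= 8 * K + 20 by rewrite
    ler_pdivrMr.
  have : d * sqnorm2 (proj_plus p) <= 4 by apply: le_trans np;
    rewrite ler_wpM2l ?(ltW d0)// sqnorm2_proj_plus.
  by move: (d * _) (_ / d) => y z hy hz; lra.
apply: (le_trans (rnorm1star_le_rnorm1 hp)).
by move: b1 b2; move: (rnorm1 _) (rnorm1 _) => y z hy hz; lra.
Qed.

(** * Arcs of the circle *)

Lemma cos_lipschitz (u v : R) : `|cos u - cos v| <= `|u - v|.
Proof.
wlog uv : u v / v <= u.
  by move=> h; have [/ltW uv|vu] := ltP u v; [rewrite distrC [leRHS]distrC|]; exact: h.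
have [x _ ->] := @MVT_segment R cos (fun x => - sin x) v u uv
  (fun x _ => is_derive_cos x) (continuous_subspaceT (@continuous_cos R)).
by rewrite normrM normrN ler_piMl// ler_norml sin_geN1 sin_le1.
Qed.

Lemma sin_lipschitz (u v : R) : `|sin u - sin v| <= `|u - v|.
Proof.
rewrite !sin_cos; apply: (le_trans (cos_lipschitz _ _)).
by rewrite (_ : _ - _ - _ = u - v)//; ring.
Qed.

(** The point [exp (2 i pi t)] of the unit circle. *)
Definition expi (t : R) : R[i] := cos (2 * pi * t) +i* sin (2 * pi * t).

Lemma expi_periodz (t : R) (k : int) : expi (t + k%:~R) = expi t.
Proof.
have c x : cos (x + 2 * pi * k%:~R) = cos x :> R.
  by rewrite -!sinDpihalf addrAC sin_periodz.
by rewrite /expi mulrDr sin_periodz c.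
Qed.

Lemma normc_expi t : normc (expi t) = 1.
Proof. by rewrite normcE /= cos2Dsin2 sqrtr1. Qed.

Lemma expi_lipschitz (u v : R) : normc (expi u - expi v) <= 4 * pi * `|u - v|.
Proof.
have pi0 : 0 <= 2 * pi :> R by rewrite mulr_ge0// pi_ge0.
have e : 2 * pi * `|u - v| = `|2 * pi * u - 2 * pi * v|.
  by rewrite -mulrBr normrM (ger0_norm pi0).
apply: (le_trans (normc_le_ReIm _)); rewrite /= (_ : 4 * pi * _ = 2 * pi * `|u - v| + 2 * pi *
  `|u - v|); last by ring.
by rewrite e lerD ?cos_lipschitz ?sin_lipschitz.
Qed.

(** An arc, which may wrap around, contains inside the fundamental domain an interval at
    least half as long. *)
Lemma arc_contains_half (a b : R) : a < b -> b <= a + 1 -> exists (c d : R) (k : int),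
  [/\ 0 <= c, c < d, d <= 1, (b - a) / 2 <= d - c & forall t, c < t < d -> a < t + k%:~R < b].
Proof.
move=> ab ba; pose k := Num.floor a.
have k1 : k%:~R <= a by exact: floor_le.
have k2 : a < k%:~R + 1 by have := floorD1_gt a; rewrite intrD.
(* If the arc passes the integer k + 1, one of the two pieces is at least half as long. *)
have [b1|b1] := leP (b - k%:~R) 1.
  exists (a - k%:~R), (b - k%:~R), k; split; rewrite ?subr_ge0 ?ltrD2r//; first by lra.
  by move=> t /andP[h1 h2]; apply/andP; split; lra.
have [h|h] := leP ((b - a) / 2) (1 - (a - k%:~R)).
  exists (a - k%:~R), 1, k; split; rewrite ?subr_ge0//; first by lra.
  by move=> t /andP[h1 h2]; apply/andP; split; lra.
exists 0, (b - k%:~R - 1), (k + 1); split; rewrite ?subr0//; try lra.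
by move=> t /andP[h1 h2]; rewrite intrD; apply/andP; split; lra.
Qed.

(** What is needed about arcs: their points are within a multiple of their measure of a
    given point of the unit circle. *)
Lemma circle_arc_spec (J : set line) : circle_arc J -> [/\ measurable J, J `<=` circle,
  0 < arclength J <= 1, haar J = (arclength J)%:E &
  exists w : R[i], normc w = 1 /\ forall t, J t -> normc (expi t - w) <= 8 * pi * arclength J].
Proof.
move=> [a [b [ba [bb [ab ba1 JE]]]]].
pose I := Interval (BSide ba a) (BSide bb b).
pose A (k : int) : set line := (fun t : line => (t : R) + k%:~R) @^-1` [set` I].
have mA k : measurable (A k).
  rewrite -[A k]setTI; apply: measurable_funD => //; exact: measurable_itv.
have mJ : measurable J.
  rewrite (_ : J = circle `&` ((\bigcup_n A n%:Z) `|` (\bigcup_n A (- n%:Z)))).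
    apply: measurableI; first exact: measurable_circle.
    by apply: measurableU; apply: bigcupT_measurable.
  rewrite JE; apply/seteqP; split => t /=.
    move=> [ct [[n|n] tk]]; split => //; first by left; exists n.
    by right; exists n.+1 => //; rewrite /A /= -NegzE.
  by move=> [ct [[n _ h]|[n _ h]]]; split => //; [exists n%:Z|exists (- n%:Z)].
have Jc : J `<=` circle by rewrite JE => t [].
have hfin : haar J = (arclength J)%:E.
  rewrite /arclength fineK// ge0_fin_numE//.
  by apply: (le_lt_trans (probability_le1 (@haar R) mJ)); rewrite ltry.
have J1 : arclength J <= 1.
  by rewrite -lee_fin -hfin; exact: (probability_le1 (@haar R) mJ).
have [c [d [k [c0 cd d1 hcd sub]]]] := arc_contains_half ab ba1.
have cdJ : `]c, d[%classic `<=` J.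
  move=> t /=; rewrite in_itv/= => /andP[ct td]; rewrite JE; split.
    by rewrite /circle /= in_itv/= (le_trans c0 (ltW ct)) (lt_le_trans td d1).
  have /andP[h1 h2] : a < t + k%:~R < b by apply: sub; rewrite ct td.
  by exists k; rewrite in_itv; case: (ba) (bb) => -[] /=; rewrite ?h1 ?h2 ?(ltW h1) ?(ltW h2).
have lo : d - c <= arclength J.
  rewrite -lee_fin -hfin /haar /mrestr setIidl//.
  have <- : lebesgue_measure (`]c, d[%classic : set R) = (d - c)%:E.
    by rewrite lebesgue_measure_itv/= lte_fin cd.
  by apply: le_measure; rewrite ?inE//; exact: measurable_itv.
split => //.
  by rewrite J1 andbT (lt_le_trans _ lo)// subr_gt0.
exists (expi a); split; first exact: normc_expi.
move=> t Jt.
have [ct [j tj]] : circle t /\ exists j : int,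
    (t : R) + j%:~R \in Interval (BSide ba a) (BSide bb b) by move: Jt; rewrite JE.
have /andP[h1 h2] : a <= (t : R) + j%:~R <= b.
  by move: tj; case: (ba) (bb) => -[]; rewrite in_itv/= => /andP[h1 h2];
    rewrite ?h1 ?h2 ?(ltW h1) ?(ltW h2).
rewrite -(expi_periodz _ j); apply: (le_trans (expi_lipschitz _ _)).
rewrite (_ : 8 * pi * _ = 4 * pi * (2 * arclength J)); last by ring.
apply: ler_wpM2l; first by rewrite mulr_ge0// pi_ge0.
rewrite ger0_norm ?subr_ge0//; move: lo hcd h2; move: (arclength J) ((t : R) + _) => z y; lra.
Qed.

(** * Atoms are uniformly bounded *)

Lemma sqnorm2_le_indic f (A : set pt) (M : R) : cL2 f -> measurable A -> 0 <= M ->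
  (forall x, torus x -> normc (f x) <= M * \1_A x) -> sqnorm2 f <= M ^+ 2 * fine (haar2 A).
Proof.
move=> hf mA M0 fM.
have hA : (\1_A : pt -> R) \in L2.
  apply: (@Lfun2_bounded _ 1); first exact: measurable_indic.
  by move=> x _; rewrite indicE; case: (_ \in _); rewrite ?normr1 ?normr0.
have cA := cL2Z M%:C (cL2_cplx hA).
apply: (@le_trans _ _ (sqnorm2 (fun x => M%:C * cplx \1_A x))).
  apply: le_sqnorm2 => // x tx; rewrite normcM /cplx !normc_real (ger0_norm M0) ger0_norm ?fM//.
rewrite sqnorm2Z; last exact: cL2_cplx.
rewrite normc_real (ger0_norm M0) ler_wpM2l ?sqr_ge0//.
rewrite /sqnorm2 /Rintegral -[X in haar2 X](setIT A) -integral_indic//.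
rewrite le_eqVlt; apply/orP; left; apply/eqP; congr fine; apply: eq_integral => x _.
by rewrite /cplx normc_real indicE; case: (_ \in _); rewrite ?normr1 ?normr0 ?expr1n ?expr0n.
Qed.

Lemma fourier_cplx0 (u : pt -> R) : fourier (cplx u) 0 = (\int[haar2]_x u x)%:C.
Proof.
rewrite /fourier /inner (_ : (fun x => _) = cplx u); last first.
  by apply/funext => x; rewrite char0 rmorph1 mulr1.
apply: complexP; rewrite /cintegral /=; first by [].
exact: Rint_cst.
Qed.

Lemma tends_to_le (u : nat -> R) (l C : R) : tends_to u l ->
  (exists N, forall n, (N <= n)%N -> u n <= C) -> l <= C.
Proof.
move=> h [N hN]; apply/ler_addgt0Pr => e /h[N' hN'].
have h1 := hN _ (leq_maxl N N'); have := hN' _ (leq_maxr N N'); rewrite /= ler_norml => /andP[h2 _].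
by move: h1 h2; move: (u _) => z; lra.
Qed.

(** The norm of a bounded function is controlled by that of the trigonometric polynomials
    close to it in L2. *)
Lemma H1R_norm_le_of_approx (u : pt -> R) (B d C : R) : measurable_fun setT u ->
  (forall x, torus x -> `|u x| <= B) -> 0 < d ->
  (forall q : pt -> R, real_trigpol q -> sqnorm2 (cplx u \- cplx q) <= d -> rnorm1star (cplx q) <=
    C) ->
  H1R u /\ (H1R_norm u <= C%:E)%E.
Proof.
move=> mu uB d0 h; have [hu [q [rq van]]] := bounded_represents mu uB.
split; first by split => //; exists q.
have [l [hl ->]] := H1R_norm_represents hu rq; rewrite lee_fin.
apply: (tends_to_le hl); have [N hN] := van _ d0; exists N => n Nn.
by apply: h; [case: rq|exact: hN].
Qed.

(** The bound of [rnorm1star_atomic_bound] for [K = (8 pi) ^ 2]. *)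
Definition atom_const : R := 72 * (64 * pi ^+ 2) + 242.

Lemma atom_const_ge4 : 4 <= atom_const.
Proof.
rewrite /atom_const; have : 0 <= pi ^+ 2 :> R by exact: sqr_ge0.
by move: (_ ^+ 2) => z; lra.
Qed.

Lemma const_H1R_norm (u : pt -> R) : measurable_fun setT u -> const1 u ->
  H1R u /\ (H1R_norm u <= atom_const%:E)%E.
Proof.
move=> mu u1.
have uB x : torus x -> `|u x| <= 1 by move=> /u1 ->; rewrite normr1.
have hu : u \in L2 by exact: Lfun2_bounded uB.
apply: (H1R_norm_le_of_approx mu uB ltr01) => q hq uq.
apply: (le_trans _ atom_const_ge4); rewrite (_ : 4 = 2 * 2 :> R); last by rewrite -natrM.
apply: rnorm1star_small => //; apply: (le_trans (sqnorm2_le_approx (cL2_cplx hu) (trigpol_cL2 hq))).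
have h1 : sqnorm2 (cplx u) <= 1.
  rewrite -[leRHS](_ : sqnorm2 (fun _ : pt => 1%:C) = 1).
    apply: le_sqnorm2; [exact: cL2_cplx|exact/trigpol_cL2/trigpol_cst|].
    by move=> x tx; rewrite /cplx u1.
  by rewrite /sqnorm2 -[RHS]Rint_cst; apply: eq_Rintegral => x _; rewrite normc_real normr1 expr1n.
apply: (le_trans (lerD (ler_wpM2l (ler0n _ 2) h1) (ler_wpM2l (ler0n _ 2) uq))).
by rewrite !mulr1 expr2 mulr_natl mulr2n.
Qed.

(** The bound for a mean-zero function carried by the strip [pr x \in J] and bounded by the
    inverse of the length of [J]. *)
Lemma strip_atom_H1R_norm (e : int * int) (pr : pt -> line) (J : set line) (a : pt -> R) :
  is_axis e -> measurable_fun setT pr -> (forall x, character e x = expi (pr x)) ->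
  haar2 (pr @^-1` J) = haar J -> circle_arc J -> measurable_fun setT a ->
  (forall x, torus x -> ~ J (pr x) -> a x = 0) ->
  (forall x, torus x -> `|a x| <= 1 / arclength J) -> \int[haar2]_x a x = 0 ->
  (forall n, ~ Xplus n -> Xplus (n + e) -> n <> - e -> fourier (cplx a) n = 0) ->
  H1R a /\ (H1R_norm a <= atom_const%:E)%E.
Proof.
move=> he mpr ch hJ arcJ ma sa ba ia cra.
have [mJ _ d01 hd [w [w1 hw]]] := circle_arc_spec arcJ.
set d := arclength J in ba d01 hd hw *; have [d0 d1] := andP d01.
have pi0 : 0 <= pi :> R := pi_ge0 R.
have mA : measurable (pr @^-1` J) by rewrite -[X in measurable X]setTI; exact: mpr.
have fA : fine (haar2 (pr @^-1` J)) = d by rewrite hJ hd.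
have ha : a \in L2 by exact: Lfun2_bounded ba.
have ca := cL2_cplx ha.
have [cw _] := cL2M_char_sub e ca w1.
apply: (H1R_norm_le_of_approx ma ba d0) => q hq aq.
apply: (rnorm1star_atomic_bound (e := e) (w := w) (d := d) (a := cplx a)) => //.
- by rewrite mulr_ge0// sqr_ge0.
- rewrite (_ : 1 / d = (1 / d) ^+ 2 * d); last by field; rewrite gt_eqF.
  rewrite -[X in _ * X]fA; apply: sqnorm2_le_indic => //; first by rewrite divr_ge0// ltW.
  move=> x tx; rewrite /cplx normc_real indicE; have [/set_mem Jx|Jx] := boolP (x \in _).
    by rewrite mulr1 ba.
  by rewrite mulr0 sa ?normr0// => Jx'; move/negP : Jx; apply; apply/mem_set.
- rewrite (_ : 64 * pi ^+ 2 * d = (8 * pi) ^+ 2 * d); last by ring.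
  rewrite -[X in _ * X]fA; apply: sqnorm2_le_indic => //; first by rewrite mulr_ge0.
  move=> x tx; rewrite normcM /cplx normc_real indicE ch; have [/set_mem Jx|Jx] := boolP (x \in _).
    rewrite mulr1 [leRHS](_ : _ = (8 * pi * d) * (1 / d)); last by field; rewrite gt_eqF.
    by rewrite ler_pM ?normc_ge0//; [exact: hw|exact: ba].
  by rewrite mulr0 sa ?normr0 ?mulr0// => Jx'; move/negP : Jx; apply; apply/mem_set.
- by rewrite fourier_cplx0 ia.
Qed.

Lemma Rint_circle_support (J : set line) (u : line -> R) : J `<=` circle ->
  (forall t, circle t -> ~ J t -> u t = 0) ->
  \int[haar]_(t in circle) u t = \int[haar]_(t in J) u t.
Proof.
move=> Jc u0; rewrite Rintegral_mkcond [RHS]Rintegral_mkcond; apply: eq_Rintegral => t _.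
rewrite !patchE; case: ifPn => [/set_mem ct|ct]; case: ifPn => [/set_mem Jt|Jt] //.
  by apply: u0 => // Jt'; move/negP : Jt; apply; apply/mem_set.
by move/negP : ct; case; apply/mem_set; exact: Jc.
Qed.

Lemma haar2_snd (J : set line) : measurable J -> haar2 (snd @^-1` J) = haar J.
Proof.
move=> mJ; rewrite (_ : _ @^-1` _ = setT `*` J); last by apply/seteqP; split=> x //= -[].
by rewrite /haar2 product_measure1E// -[RHS]mul1e; congr (_ * _)%E; exact: haar_setT.
Qed.

Lemma haar2_fst (J : set line) : measurable J -> haar2 (fst @^-1` J) = haar J.
Proof.
move=> mJ; rewrite (_ : _ @^-1` _ = J `*` setT); last by apply/seteqP; split=> x //= -[].
by rewrite /haar2 product_measure1E// -[RHS]mule1; congr (_ * _)%E; exact: haar_setT.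
Qed.

Lemma char_axis1 (x : pt) : character (1, 0) x = expi x.1.
Proof. by rewrite /character /phase /expi /= mul1r mul0r addr0. Qed.
Lemma char_axis2 (x : pt) : character (0, 1) x = expi x.2.
Proof. by rewrite /character /phase /expi /= mul1r mul0r add0r. Qed.

(** Translation by [(0, 1)] brings a single frequency into the positive cone. *)
Lemma crossing_axis2 n : ~ Xplus n -> Xplus (n + (0, 1)) -> n = - (0, 1).
Proof.
case: n => m1 n2 nX [/= h|[/= h1 h2]]; first by case: nX; left; move: h; rewrite addr0.
move: h1; rewrite addr0 => h1; have h3 : n2 < 0.
  by rewrite ltNge; apply/negP => h3; apply: nX; right.
have h4 : n2 = -1 by move: h2 h3; clear; lia.
by rewrite h1 h4.
Qed.

(** A rectangle atom is handled as a strip atom in the second variable: only its second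
    side and its total mean matter. *)
Lemma rectangle_atom_H1R_norm (a : pt -> R) : measurable_fun setT a -> rectangle_atom a ->
  H1R a /\ (H1R_norm a <= atom_const%:E)%E.
Proof.
move=> ma [J1 [J2 [arc1 arc2 sa ba ia]]].
have [mJ1 Jc1 d01 _ _] := circle_arc_spec arc1; have [mJ2 Jc2 d02 hd2 _] := circle_arc_spec arc2.
have ba2 x : torus x -> `|a x| <= 1 / arclength J2.
  by move=> tx; apply: (le_trans (ba _ tx)); rewrite ge_min lexx orbT.
apply: (@strip_atom_H1R_norm (0, 1) snd J2) => //.
- by right.
- exact: char_axis2.
- exact: haar2_snd.
- by move=> x tx Jx; apply: sa => // -[].
- have [-> _] := Rint_fubini ma ba2; apply: haar_Rint_circle_eq0 => s cs.
  rewrite (@Rint_circle_support J2) => [|//|t ct Jt]; last by apply: sa => // -[].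
  have [[t0 Jt0]|J0] := pselect (exists t0, J2 t0); last first.
    suff -> : J2 = set0 by exact: Rintegral_set0.
    by apply/seteqP; split => // t Jt; apply: J0; exists t.
  have [Js|Js] := pselect (J1 s); first by have [] := ia _ _ Js Jt0.
  transitivity (\int[haar]_(t in J2) (0 : R)); last by rewrite /Rintegral integral0.
  by apply: eq_Rintegral => t /set_mem Jt; apply: sa; [split => //; exact: Jc2|case].
- by move=> n nX /(crossing_axis2 nX).
Qed.

(** In direction [(1, 0)] infinitely many frequencies enter the positive cone, but a function
    of the first variable has no coefficient at them, except at [(-1, 0)]. *)
Lemma one_variable_atom_H1R_norm (a : pt -> R) : measurable_fun setT a -> one_variable_atom a ->
  H1R a /\ (H1R_norm a <= atom_const%:E)%E.
Proof.
move=> ma [J [b [arcJ ab b0 bb ib]]].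
have [mJ Jc d01 hd _] := circle_arc_spec arcJ.
have ib' : \int[haar]_(s in circle) b s = 0 by rewrite (Rint_circle_support Jc).
case: ab => ab.
- have ba x : torus x -> `|a x| <= 1 / arclength J.
    by move=> tx; rewrite ab// bb//; case: tx.
  apply: (@strip_atom_H1R_norm (1, 0) fst J) => //.
  + by left.
  + exact: char_axis1.
  + exact: haar2_fst.
  + by move=> x tx Jx; rewrite ab// b0//; case: tx.
  + have [_ ->] := Rint_fubini ma ba; apply: haar_Rint_circle_eq0 => t ct.
    by rewrite -[RHS]ib'; apply: eq_Rintegral => s /set_mem cs; rewrite ab.
  + have key n c : n.2 != 0 -> \int[haar2]_x (a x * cos (phase n x + c)) = 0.
      move=> n2; have := @Rint_fubini (fun x => a x * cos (phase n x + c)) (1 / arclength J).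
      case.
      * by apply: measurable_funM => //; exact: measurable_cos_phase.
      * move=> x tx; rewrite normrM -[leRHS]mulr1 ler_pM ?ba// ler_norml cos_geN1 cos_le1//.
      move=> -> _; apply: haar_Rint_circle_eq0 => s cs.
      have cc : continuous (fun t => cos (2 * pi * n.2%:~R * t + (2 * pi * (n.1%:~R * s) + c))).
        exact: continuous_cos_affine.
      transitivity (\int[haar]_(t in circle) (b s * cos (2 * pi * n.2%:~R * t +
        (2 * pi * (n.1%:~R * s) + c)))).
        apply: eq_Rintegral => t /set_mem ct; rewrite ab//; congr (_ * cos _).
        by rewrite /phase /=; ring.
      rewrite RintegralZl ?cos_mean0 ?mulr0//; first exact: measurable_circle.
      apply: (@haar_integrable_bounded _ _ 1); first exact: measurable_circle.
        exact: continuous_measurable_fun.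
      by move=> t _; rewrite ler_norml cos_geN1 cos_le1.
    move=> n nX Xn ne.
    have n2 : n.2 != 0.
      apply/eqP => n2; apply: ne; case: n n2 nX Xn => m1 n2' /= -> nX [/= h|[/= h1 h2]].
        have h3 : m1 <= 0.
          by rewrite leNgt; apply/negP => h3; apply: nX; left.
        have h4 : m1 != 0 by apply/eqP => h4; apply: nX; right; split.
        by exfalso; move: h h3 h4; clear; lia.
      by rewrite (_ : m1 = -1)//; move: h1; clear; lia.
    apply: complexP; rewrite /fourier /inner /=.
      under eq_Rintegral do rewrite mul0r subr0 -[phase _ _]addr0.
      exact: key.
    under eq_Rintegral do rewrite mul0r addr0 sin_cos mulrN -mulN1r.
    rewrite RintZ ?key ?mulr0//.
    have mc := @measurable_cos_phase n (- (pi / 2)).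
    apply: Lfun2_Lfun1; apply: (@Lfun2_bounded _ (1 / arclength J)); first exact: measurable_funM.
    by move=> x tx; rewrite normrM -[leRHS]mulr1 ler_pM ?ba// ler_norml cos_geN1 cos_le1.
- have ba x : torus x -> `|a x| <= 1 / arclength J.
    by move=> tx; rewrite ab// bb//; case: tx.
  apply: (@strip_atom_H1R_norm (0, 1) snd J) => //.
  + by right.
  + exact: char_axis2.
  + exact: haar2_snd.
  + by move=> x tx Jx; rewrite ab// b0//; case: tx.
  + have [-> _] := Rint_fubini ma ba; apply: haar_Rint_circle_eq0 => s cs.
    by rewrite -[RHS]ib'; apply: eq_Rintegral => t /set_mem ct; rewrite ab.
  + by move=> n nX /(crossing_axis2 nX).
Qed.

Lemma atom_H1R_norm (a : pt -> R) : atoms a -> H1R a /\ (H1R_norm a <= atom_const%:E)%E.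
Proof.
move=> [[ma [ca|ra]]|[ma [ca|va]]].
- exact: const_H1R_norm.
- exact: rectangle_atom_H1R_norm.
- exact: const_H1R_norm.
- exact: one_variable_atom_H1R_norm.
Qed.

(** * The linear span of the atoms *)

Lemma atom_bounded (a : pt -> R) : atoms a -> measurable_fun setT a /\
  exists B : R, forall x, torus x -> `|a x| <= B.
Proof.
have c1 : const1 a -> exists B : R, forall x, torus x -> `|a x| <= B.
  by move=> h; exists 1 => x /h ->; rewrite normr1.
move=> [[ma [/c1//|[J1 [J2 [_ _ _ ba _]]]]]|[ma [/c1//|[J [b [_ ab _ bb _]]]]]]; split => //.
  by eexists; exact: ba.
by exists (1 / arclength J) => x tx; case: ab => ->//; apply: bb; case: tx.
Qed.

Lemma linear_span_H1R : linear_span (@atoms R) `<=` @H1R R.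
Proof.
move=> _ [n [c [a [ha ->]]]].
have /choice[B hB] : forall i, exists B : R, forall x, torus x -> `|a i x| <= B.
  by move=> i; have [] := atom_bounded (ha i).
have ma i : measurable_fun setT (a i) by have [] := atom_bounded (ha i).
(* A combination of atoms is bounded on the torus. *)
have [] := @bounded_represents (fun x => \sum_(i < n) c i * a i x) (\sum_(i < n) `|c i| * B i).
- by apply: measurable_sum => i; exact: measurable_funM.
- move=> x tx; apply: (le_trans (ler_norm_sum _ _ _)); apply: ler_sum => i _.
  by rewrite normrM ler_wpM2l// hB.
by move=> h1 [q [hq _]]; split => //; exists q.
Qed.

Lemma linear_span0 (A : set (pt -> R)) : linear_span A (fun=> 0).
Proof.
exists 0%N, (fun=> 0), (fun=> fun=> 0); split; first by case.
by apply/funext => x; rewrite big_ord0.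
Qed.

Lemma linear_span_cons (A : set (pt -> R)) (c0 : R) (a0 g : pt -> R) : A a0 -> linear_span A g ->
  linear_span A (fun x => c0 * a0 x + g x).
Proof.
move=> Aa [n [c [a [ha ->]]]].
exists n.+1, (fun i => oapp c c0 (unlift ord0 i)), (fun i => oapp a a0 (unlift ord0 i)); split.
  by move=> i; case: unliftP => [j|] _ /=; [exact: ha|].
apply/funext => x; rewrite big_ord_recl unlift_none /=; congr (_ + _).
by apply: eq_bigr => i _; rewrite liftK.
Qed.

Lemma circle_arcT : circle_arc (@circle R).
Proof.
exists 0, 1, true, true; split; rewrite ?add0r//.
apply/seteqP; split => t /= ct; last by case: ct.
by split => //; exists 0; rewrite addr0.
Qed.

Lemma arclength_circle : arclength (@circle R) = 1.
Proof.
by rewrite /arclength (_ : haar circle = 1%E)//= -haar_setT /haar /mrestr setTI setIid.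
Qed.

(** A nontrivial character depending on both variables is a rectangle atom, and one
    depending on a single variable is a one-variable atom, the arcs being the whole circle. *)
Lemma cos_phase_atom n (b : R) : n != 0 -> atoms (fun x => cos (phase n x + b)).
Proof.
move=> n0.
have cos1 y : `|cos y : R| <= 1 by rewrite ler_norml cos_geN1 cos_le1.
have e1 t : n.1 != 0 -> \int[haar]_(s in circle) cos (phase n (s, t) + b) = 0.
  move=> m1; rewrite -[RHS](cos_mean0 (2 * pi * (n.2%:~R * t) + b) m1).
  by apply: eq_Rintegral => s _; congr cos; rewrite /phase /=; ring.
have e2 s : n.2 != 0 -> \int[haar]_(t in circle) cos (phase n (s, t) + b) = 0.
  move=> n2; rewrite -[RHS](cos_mean0 (2 * pi * (n.1%:~R * s) + b) n2).
  by apply: eq_Rintegral => t _; congr cos; rewrite /phase /=; ring.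
have ma := measurable_cos_phase n b.
have [m1|m1] := eqVneq n.1 0.
  have n2 : n.2 != 0 by apply: contra n0 => /eqP n2; rewrite [n]surjective_pairing m1 n2.
  right; split => //; right; exists circle, (fun t => cos (2 * pi * n.2%:~R * t + b)); split => //.
  - exact: circle_arcT.
  - by right => x _; congr cos; rewrite /phase m1 mul0r add0r mulrA.
  - by move=> t _; rewrite arclength_circle divr1; exact: cos1.
  - exact: cos_mean0.
have [n2|n2] := eqVneq n.2 0.
  right; split => //; right; exists circle, (fun t => cos (2 * pi * n.1%:~R * t + b)); split => //.
  - exact: circle_arcT.
  - by left => x _; congr cos; rewrite /phase n2 mul0r addr0 mulrA.
  - by move=> t _; rewrite arclength_circle divr1; exact: cos1.
  - exact: cos_mean0.
left; split => //; right; exists circle, circle; split.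
- exact: circle_arcT.
- exact: circle_arcT.
- by [].
- by move=> x _; rewrite arclength_circle divr1 minxx; exact: cos1.
- by move=> t1 t2 _ _; split; [exact: e1|exact: e2].
Qed.

Lemma const1_atom : atoms (fun _ : pt => 1 : R).
Proof. by left; split; [exact: measurable_cst|left]. Qed.

Lemma real_trigpol_span (q : pt -> R) : real_trigpol q -> linear_span (@atoms R) q.
Proof.
move=> [s [c qE]].
have -> : q = fun x => \sum_(n <- s) Re (c n * character n x).
  apply/funext => x; rewrite -[LHS]/(Re (cplx q x)) qE.
  by elim: s {qE} => [|n s ih]; rewrite ?big_nil// !big_cons ReD ih.
elim: s {qE} => [|n s ih]; first by under eq_fun do rewrite big_nil; exact: linear_span0.
under eq_fun do rewrite big_cons.
have [->|n0] := eqVneq n 0.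
  have := linear_span_cons (Re (c 0)) const1_atom ih.
  by under eq_fun do rewrite mulr1; under [X in _ -> _ X]eq_fun do rewrite char0 mulr1.
have := linear_span_cons (Re (c n)) (cos_phase_atom 0 n0)
  (linear_span_cons (- Im (c n)) (cos_phase_atom (- (pi / 2)) n0) ih).
rewrite (_ : (fun x => _) = fun x => Re (c n * character n x) + \sum_(n <- s) Re
  (c n * character n x))//.
by apply/funext => x; rewrite ReM /= addr0 -sin_cos mulNr addrA.
Qed.

Lemma represents_shift (q : (pt -> R)^nat) (f : pt -> R) N : represents q f ->
  represents (fun n => q n \- q N) (f \- q N).
Proof.
move=> [tq hc hl]; split.
- by move=> n; exact: real_trigpolB.
- move=> e /hc[M hM]; exists M => m n Mm Mn.
  rewrite (_ : _ \- _ = q m \- q n); first exact: hM.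
  by apply/funext => x /=; ring.
- rewrite (_ : (fun n => norm1 _) = (fun n => norm1 (f \- q n)))//.
  by apply/funext => n; congr norm1; apply/funext => x /=; ring.
Qed.

(** Truncating a representing sequence. *)
Lemma real_trigpol_dense (f : pt -> R) (e : R) : H1R f -> 0 < e ->
  exists2 q : pt -> R, real_trigpol q & (H1R_norm (f \- q)%R < e%:E)%E.
Proof.
move=> [hf [q hq]] e0; have [tq _ _] := hq.
have e2 : 0 < e / 2 by rewrite divr_gt0.
have [N hN] := represents_cauchy hq e2; exists (q N); first exact: tq.
have hf' : f \- q N \in L1 by apply: Lfun1D => //; apply/Lfun1N/real_trigpol_L1.
have [l [hl ->]] := H1R_norm_represents hf' (represents_shift N hq).
rewrite lte_fin; apply: (@le_lt_trans _ _ (e / 2));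
  last by rewrite ltr_pdivrMr// mulr_natr mulr2n ltrDl.
apply: (tends_to_le hl); exists N => n Nn; rewrite cplxB; exact: hN.
Qed.

End Torus.

Theorem proposition2 (R : realType) :
  bounded_in_H1R (@atoms R) /\ dense_in_H1R (linear_span (@atoms R)).
Proof.
split; split.
- by move=> a /atom_H1R_norm[].
- by exists atom_const => a /atom_H1R_norm[].
- exact: linear_span_H1R.
- move=> f hf e e0; have [q hq fq] := real_trigpol_dense hf e0.
  by exists q => //; exact: real_trigpol_span.
Qed.
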